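(* Let $A,B$ be R$^*$-algebras. (a) Every Jordan $^*$-isomorphism $\phi\colon A\to B$ restricts to an orthoisomorphism from $\mathcal{P}(A)$ onto $\mathcal{P}(B)$. (b) Let $n\ge 3$ be an integer. If $\psi\colon\mathcal{P}(M_n(A))\to\mathcal{P}(B)$ is an orthoisomorphism, then there exists a unique Jordan $^*$-isomorphism $\phi\colon M_n(A)\to B$ with $\phi(p)=\psi(p)$ for all $p\in\mathcal{P}(M_n(A))$.
   Context: An R$^*$-algebra is a (not necessarily closed, not necessarily unital) $^*$-subalgebra of $B(H)$, $H$ a complex Hilbert space, in which every self-adjoint element has finite spectrum. $M_n(A)$ is the $^*$-algebra of $n\times n$ matrices with entries in $A$ (itself an R$^*$-algebra). $\mathcal{P}(A)$ is the set of projections $p=p^2=p^*$ of $A$. An orthoisomorphism $\psi\colon\mathcal{P}(A)\to\mathcal{P}(B)$ is a bijection such that $pq=0\iff\psi(p)\psi(q)=0$ for all $p,q$. A Jordan $^*$-isomorphism is a complex-linear bijection $\phi$ with $\phi(x^* )=\phi(x)^*$ and $\phi(x^2)=\phi(x)^2$ for all $x$. *)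

(* Defs.v *)
(* complex numbers C := R[i] for R : realType. *)
From HB Require Import structures.
From mathcomp Require Import all_boot all_order all_algebra complex reals.
From Stdlib Require Import ClassicalEpsilon.
Set Implicit Arguments. Unset Strict Implicit. Unset Printing Implicit Defensive.
Import Order.TTheory GRing.Theory Num.Theory.
Local Open Scope ring_scope.

(* ---------- Complex Hilbert spaces ---------- *)
Section Hilbert.
Variable R : realType.
Local Notation C := (R[i]).
Variable H : lmodType C.
Variable ip : H -> H -> C.   (* inner product, linear in the first argument *)

Definition is_hilbert : Prop :=
  [/\ (forall a x y z, ip (a *: x + y) z = a * ip x z + ip y z),
      (forall x y, ip y x = (ip x y)^*),
      (forall x, 0 <= ip x x),
      (forall x, ip x x = 0 -> x = 0) &
      (* completeness: every Cauchy sequence converges in norm *)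
      (forall u : nat -> H,
         (forall eps : C, 0 < eps -> exists N, forall m n, (N <= m)%N -> (N <= n)%N ->
             ip (u m - u n) (u m - u n) < eps) ->
         exists l : H, forall eps : C, 0 < eps -> exists N, forall n, (N <= n)%N ->
             ip (u n - l) (u n - l) < eps)].

(* bounded linear operators on H, i.e. elements of B(H) *)
Definition bounded_linear (T : H -> H) : Prop :=
  (forall (a : C) x y, T (a *: x + y) = a *: T x + T y) /\
  exists M : C, forall x, ip (T x) (T x) <= M * ip x x.

(* the Hilbert-space adjoint (exists and is unique for bounded operators) *)
Definition adj (T : H -> H) : H -> H :=
  epsilon (inhabits (fun _ => 0)) (fun S => forall x y, ip (T x) y = ip x (S y)).

(* spectrum of T in B(H) *)
Definition spectrum (T : H -> H) (l : C) : Prop :=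
  ~ exists S : H -> H, bounded_linear S /\
      (forall x, S (T x - l *: x) = x) /\ (forall x, T (S x) - l *: S x = x).

(* R*-algebra: a *-subalgebra of B(H) whose self-adjoint elements have finite spectrum *)
Definition Rstar_algebra (A : (H -> H) -> Prop) : Prop :=
  (forall T, A T -> bounded_linear T) /\
  A (fun _ => 0) /\
  (forall S T, A S -> A T -> A (fun x => S x + T x)) /\
  (forall (a : C) T, A T -> A (fun x => a *: T x)) /\
  (forall S T, A S -> A T -> A (S \o T)) /\
  (forall T, A T -> A (adj T)) /\
  (forall T, A T -> adj T = T -> exists s : seq C, forall l, spectrum T l -> l \in s).
End Hilbert.

(* ---------- abstract *-algebra operations ---------- *)
Record salg (C : Type) := SAlg {
  sT :> Type;
  s0 : sT;
  sadd : sT -> sT -> sT;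
  sscale : C -> sT -> sT;
  smul : sT -> sT -> sT;
  sstar : sT -> sT }.

(* the *-algebra B(H) (operations on operators) *)
Definition opsAlg (R : realType) (H : lmodType R[i]) (ip : H -> H -> R[i]) : salg R[i] :=
  @SAlg _ (H -> H) (fun _ => 0) (fun S T x => S x + T x) (fun a T x => a *: T x)
        (fun S T => S \o T) (adj ip).

(* M_n(S): n x n matrices over S, with the usual *-algebra operations *)
Definition matAlg (C : Type) (n : nat) (S : salg C) : salg C :=
  @SAlg C 'M[sT S]_n (\matrix_(i, j) s0 S)
    (fun M N => \matrix_(i, j) sadd (M i j) (N i j))
    (fun a M => \matrix_(i, j) sscale a (M i j))
    (fun M N => \matrix_(i, j) \big[@sadd _ S / s0 S]_(k < n) smul (M i k) (N k j))
    (fun M => \matrix_(i, j) sstar (M j i)).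

(* M_n(A) as a subset of matrices over the ambient algebra *)
Definition Mn (C : Type) (n : nat) (S : salg C) (A : S -> Prop) : matAlg n S -> Prop :=
  fun M => forall i j, A (M i j).

Section Maps.
Variable C : Type.
Variables S1 S2 : salg C.
Variable A : S1 -> Prop.
Variable B : S2 -> Prop.

Definition is_proj (S : salg C) (X : S -> Prop) (p : S) : Prop :=
  [/\ X p, smul p p = p & sstar p = p].

(* orthoisomorphism P(A) -> P(B) (psi is only relevant on P(A)) *)
Definition orthoiso (psi : S1 -> S2) : Prop :=
  [/\ (forall p, is_proj A p -> is_proj B (psi p)),
      (forall q, is_proj B q -> exists! p, is_proj A p /\ psi p = q) &
      (forall p q, is_proj A p -> is_proj A q ->
         (smul p q = s0 S1 <-> smul (psi p) (psi q) = s0 S2))].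

(* Jordan *-isomorphism A -> B (phi is only relevant on A) *)
Definition jordan_star_iso (phi : S1 -> S2) : Prop :=
  (forall x, A x -> B (phi x)) /\
  (forall x y, A x -> A y -> phi x = phi y -> x = y) /\
  (forall y, B y -> exists2 x, A x & phi x = y) /\
  (forall x y, A x -> A y -> phi (sadd x y) = sadd (phi x) (phi y)) /\
  (forall a x, A x -> phi (sscale a x) = sscale a (phi x)) /\
  (forall x, A x -> phi (sstar x) = sstar (phi x)) /\
  (forall x, A x -> phi (smul x x) = smul (phi x) (phi x)).
End Maps.

(* Main.v *)
(* Dye's theorem by coordinates.  Self-adjoint elements of an R*-algebra are algebraic, so elements
   have Moore-Penrose inverses and range projections.  Fix a projection e of A, put E_i = e e_ii
   and f_i = psi(E_i).  The range projection of E_i + a e_ji is a complement of E_j in E_i + E_j,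
   so its image under psi is the range projection of f_i + alpha_ji(a) for a unique "slope"
   alpha_ji(a) in f_j B f_i.  The columns (1, a, b) and (d, 1, c) are orthogonal iff
   d + a^* + b^* c = 0, and psi preserves orthogonality: this single relation makes the alpha_ij
   additive, multiplicative and *-preserving, hence gives a *-homomorphism Phi of the ring
   M_n(e A e) into B.  Column reduction shows that Phi and psi agree on projections.  Positivity
   makes Phi real-linear; x + i y |-> Phi x + i Phi y (x, y self-adjoint) is the required Jordan
   map on M_n(e A e), and these maps are compatible because projections span. *)
From HB Require Import structures.
Require Import Defs.
From mathcomp Require Import all_boot all_order all_algebra complex reals.
From mathcomp Require Import classical_sets boolp ring lra.
From Stdlib Require Import ClassicalEpsilon.
Set Implicit Arguments. Unset Strict Implicit. Unset Printing Implicit Defensive.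
Import Order.TTheory GRing.Theory Num.Theory.
Local Open Scope ring_scope.

(** * Involutive algebras and their projections *)

(** [psi] sees only orthogonality, hence the order of projections, so every algebraic operation has
    to be read off from these. [A] may lack a unit, and then there are no matrix units to work with;
    but finitely many elements of [A] share a two-sided unit [e] in [A], which is why corners are
    treated one at a time and glued. Three rows are needed because the term b^* c, the source of
    both sums and products, sits in a row different from the two pivot rows. The resulting ring
    homomorphism need not be complex linear: on a direct summand it may be conjugate linear. Hence
    it is kept only on self-adjoint elements and extended complex linearly, which saves squares but
    not products; this is where the Jordan map comes from. As [A] need not be norm closed,
    continuous functional calculus could leave it; algebraicity is extracted from the finite
    spectrum by an extremal argument instead, and from then on the analysis enters only through
    positivity. *)

Record staralg (C : numClosedFieldType) := StarAlg {
  car :> pzRingType;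
  star : car -> car;
  scal : C -> car;
  starD : forall x y, star (x + y) = star x + star y;
  starM : forall x y, star (x * y) = star y * star x;
  starK : involutive star;
  scalD : forall k l, scal (k + l) = scal k + scal l;
  scalM : forall k l, scal (k * l) = scal k * scal l;
  scal1 : scal 1 = 1;
  scalC : forall k x, scal k * x = x * scal k;
  star_scal : forall k, star (scal k) = scal k^* }.

Section StarAlg.
Variables (C : numClosedFieldType) (L : staralg C).
Implicit Types (x y p q u : L) (k l : C).

Lemma star0 : star (0 : L) = 0.
Proof. by apply: (addrI (star 0)); rewrite -starD !addr0. Qed.
Lemma starN x : star (- x) = - star x.
Proof. by apply: (addrI (star x)); rewrite -starD !subrr star0. Qed.
Lemma starB x y : star (x - y) = star x - star y.
Proof. by rewrite starD starN. Qed.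
Lemma star1 : star (1 : L) = 1.
Proof. by rewrite -[LHS]mulr1 -{2}[1](starK (1 : L)) -starM mulr1 starK. Qed.
Lemma star_sum (I : Type) (r : seq I) (P : pred I) (F : I -> L) :
  star (\sum_(i <- r | P i) F i) = \sum_(i <- r | P i) star (F i).
Proof. by apply: (big_morph (@star C L)); [exact: starD | exact: star0]. Qed.
Lemma scal0 : scal L 0 = 0.
Proof. by apply: (addrI (scal L 0)); rewrite -scalD !addr0. Qed.
Lemma scalN k : scal L (- k) = - scal L k.
Proof. by apply: (addrI (scal L k)); rewrite -scalD !subrr scal0. Qed.
Lemma scal_nat m : scal L m%:R = m%:R.
Proof. by elim: m => [|m IH]; rewrite ?scal0 // -[m.+1]addn1 !natrD scalD IH scal1. Qed.
Lemma scalMl k x y : scal L k * (x * y) = x * (scal L k * y).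
Proof. by rewrite mulrA scalC -mulrA. Qed.
Lemma scalMM k l x y : scal L k * x * (scal L l * y) = scal L (k * l) * (x * y).
Proof. by rewrite scalM -!mulrA; congr (_ * _); rewrite scalMl. Qed.
Lemma scalVK k x : k != 0 -> scal L k^-1 * (scal L k * x) = x.
Proof. by move=> k0; rewrite mulrA -scalM mulVf // scal1 mul1r. Qed.

(** The unit of the ambient ring [L] need not lie in [X]: elements such as [1 - q] may occur in
    computations, but they are not claimed to be members. *)
Record subalg (X : L -> Prop) : Prop := {
  sub0 : X 0;
  subD : forall x y, X x -> X y -> X (x + y);
  subM : forall x y, X x -> X y -> X (x * y);
  subS : forall x, X x -> X (star x);
  subZ : forall k x, X x -> X (scal L k * x) }.

(** In B(H) the quadratic form of the sum at [v] is the sum of the [|x i v|^2]. Whole families are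
    considered because columns of matrices produce such sums. *)
Definition posdef := forall m (x : 'I_m -> L),
  \sum_i star (x i) * x i = 0 -> forall i, x i = 0.

Definition regular (X : L -> Prop) := forall a, X a -> exists2 b, X b &
  [/\ a * b * a = a, b * a * b = b, star (a * b) = a * b & star (b * a) = b * a].

Definition proj (X : L -> Prop) p := [/\ X p, p * p = p & star p = p].

Definition local_units (X : L -> Prop) := forall p q, X p -> X q ->
  exists2 u, proj X u & [/\ u * p = p, p * u = p, u * q = q & q * u = q].

Section Sub.
Variables (X : L -> Prop) (sX : subalg X).
Lemma subN x : X x -> X (- x).
Proof. by move/(subZ sX (-1)); rewrite scalN scal1 mulN1r. Qed.
Lemma subB x y : X x -> X y -> X (x - y).
Proof. by move=> hx hy; apply: (subD sX) => //; apply: subN. Qed.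
Lemma sub_sum (I : Type) (r : seq I) (P : pred I) (F : I -> L) :
  (forall i, P i -> X (F i)) -> X (\sum_(i <- r | P i) F i).
Proof. by move=> h; apply: big_ind => //; [exact: sub0 | exact: subD]. Qed.

Lemma proj0 : proj X 0.
Proof. by split; rewrite ?mul0r ?star0 //; exact: sub0. Qed.

Lemma projD p q : proj X p -> proj X q -> p * q = 0 -> proj X (p + q).
Proof.
move=> [Xp pp sp] [Xq qq sq] pq; have qp : q * p = 0 by rewrite -sq -sp -starM pq star0.
by split; [exact: subD | rewrite mulrDl !mulrDr pp qq pq qp addr0 add0r | rewrite starD sp sq].
Qed.

Lemma proj_leC p q : proj X p -> proj X q -> q * p = p -> p * q = p.
Proof. by move=> [_ _ sp] [_ _ sq] h; rewrite -{1}sp -sq -starM h. Qed.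
Lemma proj_geC p q : proj X p -> proj X q -> p * q = p -> q * p = p.
Proof. by move=> [_ _ sp] [_ _ sq] h; rewrite -{1}sp -sq -starM h. Qed.

Lemma projB p q : proj X p -> proj X q -> q * p = p -> proj X (q - p).
Proof.
move=> pp pq h; have h' := proj_leC pp pq h.
case: pp pq => [Xp pp sp] [Xq qq sq]; split; [exact: subB | | by rewrite starB sp sq].
by rewrite mulrBl !mulrBr pp qq h h' subrr subr0.
Qed.

Lemma proj_le_anti p q : proj X p -> proj X q -> q * p = p -> p * q = q -> p = q.
Proof. by move=> pp pq h1 h2; rewrite -(proj_leC pp pq h1). Qed.

(** With a common unit [u] of [p] and [q], the test projection [r = u - q] gives [(u - q) * p = 0].
    The order is thus expressed by orthogonality without a global unit. *)
Lemma proj_le_orth p q : local_units X -> proj X p -> proj X q ->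
  (forall r, proj X r -> r * q = 0 -> r * p = 0) -> q * p = p.
Proof.
move=> lu pp pq h; have [Xp _ _] := pp; have [Xq _ _] := pq.
have [u pu [u1 _ u3 _]] := lu _ _ Xp Xq.
have := h _ (projB pq pu u3); rewrite !mulrBl u1 u3.
by have [_ -> _] := pq; rewrite subrr => /(_ erefl)/eqP; rewrite subr_eq0 => /eqP <-.
Qed.

Lemma posdef1 : posdef -> forall x, star x * x = 0 -> x = 0.
Proof. by move=> pd x h; apply: (pd 1%N (fun=> x) _ ord0); rewrite big_ord1. Qed.

(** The element [h] controls every [x i] from both sides: if [h * z = 0], positivity gives
    [x i * z = 0] and [star (x i) * z = 0]. Apply this to [z = 1 - q] with [q] the support of [h];
    the two kinds of terms form one family over ['I_(m + m)]. *)
Lemma regular_units : posdef -> regular X -> forall m (x : 'I_m -> L),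
  (forall i, X (x i)) -> exists2 u, proj X u & forall i, u * x i = x i /\ x i * u = x i.
Proof.
move=> pd rX m x Xx.
pose h := \sum_i (star (x i) * x i + x i * star (x i)).
have Xh : X h.
  by apply: sub_sum => i _; apply: (subD sX); apply: (subM sX) => //; apply: (subS sX).
have [b Xb [h1 h2 h3 h4]] := rX _ Xh.
have hs : star h = h by rewrite star_sum; apply: eq_bigr => i _; rewrite starD !starM !starK.
pose q := b * h; have pq : proj X q.
  by split; [exact: (subM sX) | rewrite /q mulrA h2 | ].
exists q => //.
have [z ez] : exists z, z = 1 - q by exists (1 - q).
have hz : h * z = 0 by rewrite ez mulrBr mulr1 /q mulrA h1 subrr.
have key : \sum_(i < m + m) star ((match split i with inl i => x i | inr i => star (x i) end) * z)
   * ((match split i with inl i => x i | inr i => star (x i) end) * z) = 0.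
  rewrite big_split_ord /= -big_split /=.
  transitivity (star z * h * z); last by rewrite -mulrA hz mulr0.
  rewrite /h mulr_sumr mulr_suml; apply: eq_bigr => i _.
  rewrite (unsplitK (inl i)) (unsplitK (inr i)) !starM starK.
  by rewrite mulrDr mulrDl !mulrA.
move=> i; have ha j := pd _ _ key j; have := ha (lshift m i); have := ha (rshift m i).
rewrite (unsplitK (inl i)) (unsplitK (inr i)) ez !mulrBr !mulr1.
move=> /eqP; rewrite subr_eq0 => /eqP e1 /eqP; rewrite subr_eq0 => /eqP e2; split => //.
by rewrite -[x i]starK {2}e1 starM; case: pq => _ _ ->.
Qed.

Lemma regular_local_units : posdef -> regular X -> local_units X.
Proof.
move=> pd rX p q Xp Xq.
have [|u pu hu] := regular_units pd rX (x := fun i : 'I_2 => if i == ord0 then p else q).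
  by move=> i; case: ifP.
by exists u => //; have [] := hu ord0; have [] := hu ord_max; split.
Qed.

(* The Moore-Penrose inverse of [a] is [k a^*], with [k] the group inverse of [a^* a]. *)
Lemma regular_of_selfadjoint : posdef ->
  (forall h, X h -> star h = h -> exists2 k, X k & [/\ h * k = k * h, h * k * h = h & k * h * k = k]) ->
  regular X.
Proof.
move=> pd hX a Xa; pose h := star a * a.
have Xh : X h by apply: (subM sX) => //; apply: (subS sX).
have hs : star h = h by rewrite /h starM starK.
have [k Xk [hk1 hk2 hk3]] := hX h Xh hs.
pose q := k * h.
have qs : star q = q.
  have e : q * star q = star q by rewrite /q starM hs mulrA -hk1 hk2.
  by rewrite -{2}[q]starK -e starM starK.
have aq : a * q = a.
  apply/eqP; rewrite eq_sym -subr_eq0; apply/eqP/(posdef1 pd); rewrite starB starM qs.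
  have e : star a * (a - a * q) = 0 by rewrite mulrBr mulrA -/h /q mulrA hk2 subrr.
  by rewrite mulrBl -mulrA e mulr0 subrr.
(* Adjoints of the equations for [k] give [h * star k = star k * h = q], so both [k] and [star k]
   equal [q * star k]. *)
have ks : star k = k.
  have hks : h * star k = q by rewrite -qs /q starM hs.
  have e1 : k = q * star k by rewrite -[LHS]hk3 -mulrA hk1 -/q -[in LHS]hks mulrA.
  have hks' : star k * h = q by rewrite -hs -starM hk1 -/q qs.
  have e2 : star k = q * star k by rewrite -[in LHS]hk3 2!starM hs mulrA hks'.
  by rewrite e2 -e1.
exists (k * star a); first by apply: (subM sX) => //; apply: (subS sX).
have kah : k * star a * a = q by rewrite -mulrA.
split; rewrite ?kah //.
- by rewrite -mulrA kah aq.
- by rewrite /q mulrA hk3.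
- by rewrite !starM starK ks mulrA.
Qed.

End Sub.

(** Minimality of [p] is encoded by the equation [p = w * z], with [z] anywhere in the ambient
    algebra: whatever kills [w] from the left then kills [p]. *)
Definition range_proj (X : L -> Prop) p w := [/\ proj X p, p * w = w & exists z, p = w * z].

Lemma range_proj_unique X p q w : range_proj X p w -> range_proj X q w -> p = q.
Proof.
move=> [pp pw [z pz]] [pq qw [z' qz]]; apply: (proj_le_anti pp pq).
  by rewrite pz mulrA qw.
by rewrite qz mulrA pw.
Qed.

Lemma range_proj_le X p w x : range_proj X p w -> x * w = 0 -> x * p = 0.
Proof. by move=> [_ _ [z ->]] h; rewrite mulrA h mul0r. Qed.

Lemma range_proj_orth X p q w v : range_proj X p w -> range_proj X q v ->
  (star w * v = 0 <-> p * q = 0).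
Proof.
move=> [[Xp pp sp] pw [z pz]] [_ qv [z' qz]]; split => h.
  by rewrite -sp pz qz starM -!mulrA [star w * _]mulrA h mul0r mulr0.
by rewrite -pw -qv starM sp -mulrA [p * _]mulrA h mul0r mulr0.
Qed.

End StarAlg.
Arguments scal {C} _ _.

(** * Matrix algebras and orthoisomorphisms *)

Section Matrices.
Variables (C : numClosedFieldType) (L : staralg C) (n : nat).
Implicit Types (x y : 'M[L]_n) (a b : L) (i j k : 'I_n).

Definition mstar x : 'M[L]_n := \matrix_(i, j) star (x j i).

Lemma mstarD x y : mstar (x + y) = mstar x + mstar y.
Proof. by apply/matrixP => i j; rewrite !mxE starD. Qed.
Lemma mstarM x y : mstar (x * y) = mstar y * mstar x.
Proof.
apply/matrixP => i j; rewrite !mxE star_sum; apply: eq_bigr => k _.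
by rewrite !mxE starM.
Qed.
Lemma mstarK : involutive mstar.
Proof. by move=> x; apply/matrixP => i j; rewrite !mxE starK. Qed.
Lemma mscalD (s t : C) : (scal L (s + t))%:M = (scal L s)%:M + (scal L t)%:M :> 'M[L]_n.
Proof. by rewrite scalD raddfD. Qed.
Lemma mscalM (s t : C) : (scal L (s * t))%:M = (scal L s)%:M * (scal L t)%:M :> 'M[L]_n.
Proof. by rewrite scalM scalar_mxM. Qed.
Lemma mscal1 : (scal L 1)%:M = 1 :> 'M[L]_n.
Proof. by rewrite scal1. Qed.
Lemma mscalE s x i j : ((scal L s)%:M * x) i j = scal L s * x i j.
Proof. by rewrite -[_ * x]/((scal L s)%:M *m x) mul_scalar_mx mxE. Qed.
Lemma mscalC s x : (scal L s)%:M * x = x * (scal L s)%:M.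
Proof.
apply/matrixP => i j; rewrite mscalE !mxE (bigD1 j) //= big1 ?addr0 => [|l /negPf nl].
  by rewrite !mxE eqxx scalC.
by rewrite !mxE nl mulr0.
Qed.
Lemma mstar_scal s : mstar (scal L s)%:M = (scal L s^*)%:M.
Proof.
by apply/matrixP => i j; rewrite !mxE eq_sym; case: eqP => _; rewrite ?star_scal ?star0.
Qed.

Definition mat_staralg : staralg C :=
  @StarAlg C ('M[L]_n : pzRingType) mstar (fun s => (scal L s)%:M) mstarD mstarM mstarK
    mscalD mscalM mscal1 mscalC mstar_scal.

Definition mat_sub (A : L -> Prop) (x : mat_staralg) := forall i j, A ((x : 'M[L]_n) i j).

Lemma mat_subalg A : subalg A -> subalg (mat_sub A).
Proof.
move=> sA; split.
- by move=> i j; rewrite mxE; exact: sub0.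
- by move=> x y hx hy i j; rewrite mxE; exact: subD.
- by move=> x y hx hy i j; rewrite mxE; apply: sub_sum => // k _; apply: (subM sA).
- by move=> x hx i j; rewrite mxE; apply: (subS sA).
- by move=> k x hx i j; rewrite mscalE; apply: (subZ sA).
Qed.

Definition mu a i j : mat_staralg := \matrix_(k, l) if (k == i) && (l == j) then a else 0.

Lemma muE a i j k l : (mu a i j : 'M[L]_n) k l = if (k == i) && (l == j) then a else 0.
Proof. by rewrite mxE. Qed.
Lemma mu0 i j : mu 0 i j = 0.
Proof. by apply/matrixP => k l; rewrite !mxE; case: ifP. Qed.
Lemma muD a b i j : mu (a + b) i j = mu a i j + mu b i j.
Proof. by apply/matrixP => k l; rewrite !mxE; case: ifP; rewrite ?addr0. Qed.
Lemma muN a i j : mu (- a) i j = - mu a i j.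
Proof. by apply/matrixP => k l; rewrite !mxE; case: ifP; rewrite ?oppr0. Qed.
Lemma mu_star a i j : star (mu a i j) = mu (star a) j i.
Proof. by apply/matrixP => k l; rewrite !mxE andbC; case: ifP; rewrite ?star0. Qed.
Lemma muM a b i j k : mu a i j * mu b j k = mu (a * b) i k.
Proof.
apply/matrixP => p q; rewrite !mxE (bigD1 j) //= big1 ?addr0 => [|l /negPf nl].
  by rewrite !mxE !eqxx andbT /=; do 2?case: eqP => _; rewrite /= ?mul0r ?mulr0.
by rewrite !mxE nl !andbF mul0r.
Qed.
Lemma muM0 a b i j k l : j != k -> mu a i j * mu b k l = 0.
Proof.
move=> /negPf jk; apply/matrixP => p q; rewrite !mxE big1 // => m _; rewrite !mxE.
case: eqP => [_|]; rewrite ?mul0r //=; case: eqP => [->|]; rewrite ?mul0r //=.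
by rewrite jk mulr0.
Qed.
Lemma mat_sub_mu A a i j : subalg A -> A a -> mat_sub A (mu a i j).
Proof. by move=> sA Aa k l; rewrite muE; case: ifP => // _; exact: sub0. Qed.
Lemma mu_mulr a i j (x : mat_staralg) k l :
  (x * mu a i j : 'M[L]_n) k l = if l == j then (x : 'M[L]_n) k i * a else 0.
Proof.
rewrite mxE (bigD1 i) //= big1 ?addr0 => [|m /negPf nm].
  by rewrite muE eqxx /=; case: ifP; rewrite ?mulr0.
by rewrite muE nm mulr0.
Qed.
Lemma mu_mull a i j (x : mat_staralg) k l :
  (mu a i j * x : 'M[L]_n) k l = if k == i then a * (x : 'M[L]_n) j l else 0.
Proof.
rewrite mxE (bigD1 j) //= big1 ?addr0 => [|m /negPf nm].
  by rewrite muE eqxx andbT; case: ifP; rewrite ?mul0r.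
by rewrite muE nm andbF mul0r.
Qed.
Lemma mat_sum_mu (x : mat_staralg) : x = \sum_i \sum_j mu ((x : 'M[L]_n) i j) i j.
Proof.
apply/matrixP => k l; rewrite summxE (bigD1 k) //= summxE (bigD1 l) //= muE !eqxx /=.
rewrite big1 ?addr0 => [|j /negPf nj]; last by rewrite muE [l == j]eq_sym nj andbF.
rewrite big1 ?addr0 // => i /negPf ni; rewrite summxE big1 // => j _.
by rewrite muE [k == i]eq_sym ni.
Qed.

Lemma proj_mu A c i : subalg A -> proj A c -> proj (mat_sub A) (mu c i i).
Proof.
move=> sA [Ac cc sc]; split; [exact: mat_sub_mu | by rewrite muM cc | by rewrite mu_star sc].
Qed.

(** The entries of all the matrices are listed as one finite family, so that a single [e] places all
    of them in M_n(e A e). *)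
Lemma mat_units (A : L -> Prop) : posdef L -> subalg A -> regular A ->
  forall m (x : 'I_m -> mat_staralg), (forall t, mat_sub A (x t)) ->
  exists2 e, proj A e & forall t i j, e * (x t : 'M[L]_n) i j = (x t : 'M[L]_n) i j /\
    (x t : 'M[L]_n) i j * e = (x t : 'M[L]_n) i j.
Proof.
move=> pd sA rA m x hx.
pose I := ('I_m * ('I_n * 'I_n))%type.
pose F (t : 'I_#|{: I}|) := let v := enum_val t in (x v.1 : 'M[L]_n) v.2.1 v.2.2.
have [|e pe he] := regular_units sA pd rA (x := F); first by move=> t; exact: hx.
exists e => // t i j; have := he (enum_rank ((t, (i, j)) : I)).
by rewrite /F enum_rankK.
Qed.

Lemma scalar_mx_mull (e : L) x i j : ((e%:M : 'M[L]_n) * x) i j = e * x i j.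
Proof. by rewrite -[_ * x]/(e%:M *m x) mul_scalar_mx mxE. Qed.
Lemma scalar_mx_mulr (e : L) x i j : (x * (e%:M : 'M[L]_n)) i j = x i j * e.
Proof.
rewrite !mxE (bigD1 j) //= big1 ?addr0 => [|l /negPf nl]; first by rewrite mxE eqxx.
by rewrite mxE nl mulr0.
Qed.

Lemma proj_scalar_mx A (e : L) : subalg A -> proj A e -> proj (mat_sub A) (e%:M : 'M[L]_n).
Proof.
move=> sA [Ae ee se]; split.
- by move=> i j; rewrite mxE; case: eqP => _ //=; exact: sub0.
- by apply/matrixP => i j; rewrite scalar_mx_mull !mxE; case: eqP => _; rewrite ?mulr1n ?ee //= mulr0.
- by apply/matrixP => i j; rewrite !mxE eq_sym; case: eqP => _; rewrite ?se //= star0.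
Qed.

Lemma mat_local_units (A : L -> Prop) : posdef L -> subalg A -> regular A ->
  local_units (mat_sub A).
Proof.
move=> pd sA rA p q hp hq.
have [|e pe he] := mat_units pd sA rA (x := fun t : 'I_2 => if t == ord0 then p else q).
  by move=> t; case: ifP.
exists (e%:M : 'M[L]_n); first exact: proj_scalar_mx.
have h0 i j := he ord0 i j; have h1 i j := he ord_max i j; rewrite /= in h0 h1.
split; apply/matrixP => i j; rewrite ?scalar_mx_mull ?scalar_mx_mulr.
- exact: (h0 i j).1.
- exact: (h0 i j).2.
- exact: (h1 i j).1.
- exact: (h1 i j).2.
Qed.

End Matrices.

Section Orthoiso.
Variables (C : numClosedFieldType) (S T : staralg C) (X : S -> Prop) (Y : T -> Prop).
Variables (psi : S -> T) (sX : subalg X) (sY : subalg Y).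
Hypotheses (luX : local_units X) (luY : local_units Y).
Hypothesis psiP : forall p, proj X p -> proj Y (psi p).
Hypothesis psi_surj : forall q, proj Y q -> exists2 p, proj X p & psi p = q.
Hypothesis psiO : forall p q, proj X p -> proj X q -> (p * q = 0 <-> psi p * psi q = 0).

(** By [proj_le_orth] the order is a statement about orthogonality to test projections; surjectivity
    writes those on the target side as [psi r]. *)
Lemma orthoiso_le p q : proj X p -> proj X q -> (q * p = p <-> psi q * psi p = psi p).
Proof.
move=> pp pq; split => h.
  apply: (proj_le_orth sY) => // [||_ /psi_surj[r pr <-]]; try exact: psiP.
  move/(psiO pr pq) => rq; apply/(psiO pr pp).
  by rewrite -h mulrA rq mul0r.
apply: (proj_le_orth sX) => // r pr /(psiO pr pq) rq; apply/(psiO pr pp).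
by rewrite -h mulrA rq mul0r.
Qed.

Lemma orthoiso_inj p q : proj X p -> proj X q -> psi p = psi q -> p = q.
Proof.
move=> pp pq e; have [_ ee _] := psiP pq.
by apply: (proj_le_anti pp pq); apply/orthoiso_le => //; rewrite e.
Qed.

Lemma orthoiso0 : psi 0 = 0.
Proof.
have p0 := proj0 sX; have [_ <- _] := psiP p0.
by apply/psiO => //; rewrite mul0r.
Qed.

(** A projection is determined by the projections orthogonal to it, and [r] is orthogonal to [p + q]
    exactly when it is orthogonal to both. The preimage [t] of [psi p + psi q] passes the same
    tests. *)
Lemma orthoisoD p q : proj X p -> proj X q -> p * q = 0 -> psi (p + q) = psi p + psi q.
Proof.
move=> pp pq o; have ps := projD sX pp pq o.
have o' := (psiO pp pq).1 o.
have [t pt et] := psi_surj (projD sY (psiP pp) (psiP pq) o').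
rewrite -et; congr psi.
have [_ ppp spp] := psiP pp; have [_ pqq sqq] := psiP pq.
have qp' : psi q * psi p = 0 by rewrite -spp -sqq -starM o' star0.
have le x : x * (psi p + psi q) = 0 -> x * psi p = 0 /\ x * psi q = 0.
  move=> h; split.
    by have := congr1 (fun z => z * psi p) h; rewrite mul0r -mulrA mulrDl ppp qp' addr0.
  by have := congr1 (fun z => z * psi q) h; rewrite mul0r -mulrA mulrDl pqq o' add0r.
have [_ ppp0 spp0] := pp; have [_ pqq0 sqq0] := pq.
have qp : q * p = 0 by rewrite -spp0 -sqq0 -starM o star0.
apply: (proj_le_anti ps pt).
  apply: (proj_le_orth sX) => // r pr /(psiO pr pt); rewrite et => /le[h1 h2].
  by rewrite mulrDr (psiO pr pp).2 // (psiO pr pq).2 // addr0.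
apply: (proj_le_orth sX) => // r pr h; apply/(psiO pr pt); rewrite et mulrDr.
have h1 : r * p = 0.
  by have := congr1 (fun z => z * p) h; rewrite mul0r -mulrA mulrDl ppp0 qp addr0.
have h2 : r * q = 0.
  by have := congr1 (fun z => z * q) h; rewrite mul0r -mulrA mulrDl pqq0 o add0r.
by rewrite (psiO pr pp).1 // (psiO pr pq).1 // addr0.
Qed.

Lemma orthoisoB p q : proj X p -> proj X q -> q * p = p -> psi (q - p) = psi q - psi p.
Proof.
move=> pp pq h; have pd := projB sX pp pq h.
have o : (q - p) * p = 0 by rewrite mulrBl h; case: pp => _ ->; rewrite subrr.
by rewrite -{2}[q](subrK p) (orthoisoD pd pp o) addrK.
Qed.
End Orthoiso.

(** * Coordinatization over a corner e A e *)

Section Coordinates.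
Variables (C : numClosedFieldType) (L T : staralg C) (n : nat).
Variables (A : L -> Prop) (B : T -> Prop) (psi : mat_staralg L n -> T).
Hypotheses (pdL : posdef L) (pdT : posdef T).
Hypotheses (sA : subalg A) (sB : subalg B) (rA : regular A) (rB : regular B).
Local Notation M := (@mat_sub C L n A).
Local Notation "x @ [ i , j ]" := ((x : 'M[car L]_n) i j) (at level 10, format "x @ [ i ,  j ]").
Hypothesis psiP : forall p, proj M p -> proj B (psi p).
Hypothesis psi_surj : forall q, proj B q -> exists2 p, proj M p & psi p = q.
Hypothesis psiO : forall p q, proj M p -> proj M q -> (p * q = 0 <-> psi p * psi q = 0).
Variables (e : L) (pe : proj A e).
Implicit Types (a b c : L) (i j k : 'I_n) (w : mat_staralg L n).

Let sM : subalg M := mat_subalg n sA.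
Let luM : local_units M := @mat_local_units C L n A pdL sA rA.
Let luB : local_units B := regular_local_units sB pdT rB.
Let psi_le := orthoiso_le sM sB luM luB psiP psi_surj psiO.
Let psi0 := orthoiso0 sM psiP psiO.
Let psiD := orthoisoD sM sB luM psiP psi_surj psiO.
Let psiB := orthoisoB sM sB luM psiP psi_surj psiO.

Definition corner a := [/\ A a, e * a = a & a * e = a].
Local Notation Ae := corner.

Lemma corner_e : Ae e.
Proof. by case: pe => Ae ee _; split. Qed.
Lemma corner0 : Ae 0.
Proof. by split; rewrite ?mulr0 ?mul0r //; exact: sub0. Qed.
Lemma cornerD a b : Ae a -> Ae b -> Ae (a + b).
Proof. by move=> [h1 h2 h3] [h4 h5 h6]; split; rewrite ?mulrDl ?mulrDr ?h2 ?h3 ?h5 ?h6 //; exact: subD. Qed.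
Lemma cornerN a : Ae a -> Ae (- a).
Proof. by move=> [h1 h2 h3]; split; rewrite ?mulrN ?mulNr ?h2 ?h3 //; exact: subN. Qed.
Lemma cornerM a b : Ae a -> Ae b -> Ae (a * b).
Proof. by move=> [h1 h2 h3] [h4 h5 h6]; split; rewrite ?mulrA ?h2 -?mulrA ?h6 //; exact: subM. Qed.
Lemma cornerS a : Ae a -> Ae (star a).
Proof.
move=> [h1 h2 h3]; have [_ _ se] := pe; split; first exact: (subS sA).
  by rewrite -{1}se -starM h3.
by rewrite -{1}se -starM h2.
Qed.

Definition ediag i : mat_staralg L n := @mu C L n e i i.
Definition fdiag i := psi (ediag i).
Local Notation mu := (@mu C L n).

Lemma projE i : proj M (ediag i). Proof. exact: proj_mu. Qed.
Lemma projf i : proj B (fdiag i). Proof. exact/psiP/projE. Qed.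
Lemma fM i : fdiag i * fdiag i = fdiag i. Proof. by case: (projf i). Qed.
Lemma fS i : star (fdiag i) = fdiag i. Proof. by case: (projf i). Qed.
Lemma EM i : ediag i * ediag i = ediag i. Proof. by case: (projE i). Qed.
Lemma EM0 i j : i != j -> ediag i * ediag j = 0. Proof. exact: muM0. Qed.
Lemma fM0 i j : i != j -> fdiag i * fdiag j = 0.
Proof. by move=> ij; apply/psiO; [exact: projE | exact: projE | exact: EM0]. Qed.

(* The column vector [w] is in reduced form with pivot the projection [c] in row [i]. *)
Definition pivot i c w := [/\ mat_sub Ae w, proj A c, e * c = c, w * mu c i i = w & ediag i * w = mu c i i].

Lemma pivot_row i c w : pivot i c w -> w @[i, i] = c.
Proof.
move=> [hw _ _ _ /matrixP/(_ i i)]; rewrite mu_mull muE !eqxx /=.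
by have [_ -> _] := hw i i.
Qed.
Lemma pivot_col i c w k l : pivot i c w -> w @[k, l] = if l == i then w @[k, i] * c else 0.
Proof. by move=> [_ _ _ /matrixP/(_ k l) <- _]; rewrite mu_mulr. Qed.

Lemma pivot_starM i c w : pivot i c w ->
  star w * w = mu (\sum_k star (w @[k, i]) * w @[k, i]) i i.
Proof.
move=> hw; apply/matrixP => k l; rewrite muE mxE.
case: eqP => [->|ki]; last first.
  apply: big1 => m _; rewrite mxE (pivot_col m k hw).
  by case: eqP => // _; rewrite star0 mul0r.
case: eqP => [->|li] /=; first by apply: eq_bigr => m _; rewrite mxE.
by apply: big1 => m _; rewrite (pivot_col m l hw); case: eqP => // _; rewrite mulr0.
Qed.

(** [star w * w] has one entry [h], and [h] is invertible in the corner of [c]: if [h * z = 0] and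
    [c * z = z], positivity kills the pivot component of [w] times [z], which is [z] itself. With
    [b] the inverse, the projection is [w * mu b i i * star w]. *)
Lemma pivot_range i c w : pivot i c w -> exists P, range_proj M P w.
Proof.
move=> hw; have [Mw pc ec wc Ew] := hw; have [Ac cc sc] := pc.
have wkc k : w @[k, i] * c = w @[k, i] by rewrite [RHS](pivot_col k i hw) eqxx.
have [h eh] : exists h, h = \sum_k star (w @[k, i]) * w @[k, i] by eexists.
have ww := pivot_starM hw; rewrite -eh in ww.
have Ah : A h.
  rewrite eh; apply: sub_sum => // k _; have [? _ _] := Mw k i.
  by apply: (subM sA) => //; apply: (subS sA).
have sh : star h = h by rewrite eh star_sum; apply: eq_bigr => k _; rewrite starM starK.
have hc : h * c = h by rewrite eh mulr_suml; apply: eq_bigr => k _; rewrite -mulrA wkc.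
have ch : c * h = h by rewrite -{1}sc -sh -starM hc.
have [b Ab [h1 h2 h3 h4]] := rA Ah.
have cb : c * b = b.
  have e1 : b = h * (star b * b) by rewrite -[LHS]h2 -{1}h4 starM sh mulrA.
  by rewrite e1 mulrA ch.
have bc : b * c = b.
  have e1 : b = b * star b * h by rewrite -[LHS]h2 -!mulrA -{1}h3 starM sh.
  by rewrite {1}e1 -mulrA hc -e1.
have [z ez] : exists z, z = c - b * h by eexists.
have hz : h * z = 0 by rewrite ez mulrBr hc mulrA h1 subrr.
have z0 : z = 0.
  have cz : c * z = z by rewrite ez mulrBr cc mulrA cb.
  rewrite -cz -{1}(pivot_row hw); apply: (@pdL n (fun k => w @[k, i] * z) _ i).
  transitivity (star z * (h * z)); last by rewrite hz mulr0.
  rewrite eh mulr_suml mulr_sumr; apply: eq_bigr => k _.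
  by rewrite starM !mulrA.
have bh : b * h = c by apply/eqP; rewrite eq_sym -subr_eq0 -ez z0.
have hsb : h * star b = c by rewrite -sh -starM bh sc.
have cs : c * star b = star b by rewrite -{1}sc -starM bc.
have sb : star b = b by rewrite -cs -bh -mulrA hsb bc.
pose P := w * mu b i i * star w.
have Pw : P * w = w by rewrite /P -!mulrA ww muM bh.
exists P; split=> //; last by exists (mu b i i * star w); rewrite mulrA.
have Mw' : M w by move=> k l; case: (Mw k l).
split; last by rewrite /P !starM starK mu_star sb mulrA.
  apply: (subM sM); last exact: (subS sM).
  by apply: (subM sM) => //; apply: mat_sub_mu.
by rewrite {2}/P mulrA mulrA Pw.
Qed.

Definition graph_col j i a := ediag i + mu a j i.

Lemma pivotE i : pivot i e (ediag i).
Proof.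
split=> //; rewrite ?EM //; last by case: pe.
by move=> k l; rewrite muE; case: ifP => _; [exact: corner_e | exact: corner0].
Qed.

Lemma pivot_add i w j a : j != i -> pivot i e w -> Ae a -> pivot i e (w + mu a j i).
Proof.
move=> ji [Mw pc ec wc Ew] ha; have [_ ea ae] := ha; split=> //.
- move=> k l; rewrite mxE; apply: cornerD => //.
  by rewrite muE; case: ifP => _ //; exact: corner0.
- by rewrite mulrDl wc muM ae.
- by rewrite mulrDr Ew muM0 ?addr0 // eq_sym.
Qed.

Lemma pivot_vec j i a : j != i -> Ae a -> pivot i e (graph_col j i a).
Proof. by move=> ji ha; apply: pivot_add => //; exact: pivotE. Qed.

Lemma range_regular x : B x -> exists2 q, range_proj B q x & exists2 y, B y & q = x * y.
Proof.
move=> Bx; have [y By [h1 h2 h3 h4]] := rB Bx; exists (x * y); last by exists y.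
split; [split | by [] | by exists y] => //; first exact: (subM sB).
by rewrite mulrA h1.
Qed.

(* [fdiag i + g] spans the image of the range projection of the column [e_i + a e_j]. *)
Definition graph j i a g := [/\ B g, fdiag j * g = g, g * fdiag i = g &
  forall P, range_proj M P (graph_col j i a) -> range_proj B (psi P) (fdiag i + g)].

(** Compressing [g = psi P] to row [i] gives [x = fdiag i * g], which is invertible between [g] and
    [fdiag i]: a defect on either side would be the image of a projection that has to vanish. The
    inverse [y] satisfies [fdiag i * y = fdiag i], so its other component [fdiag j * y] is the
    slope. *)
Lemma graph_exists j i a : j != i -> Ae a -> exists g, graph j i a g.
Proof.
move=> ji ha; have hw := pivot_vec ji ha; have [P hP] := pivot_range hw.
have [pP Pw [z Pz]] := hP; set w := graph_col j i a in hw hP Pw Pz.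
have [_ _ _ wE Ew] := hw; rewrite -/(ediag i) in wE Ew.
have [g eg] : exists g, g = psi P by eexists.
have pg : proj B g by rewrite eg; apply: psiP.
have [Bg gg sg] := pg; have [Bf ff sf] := projf i.
have fgg : (fdiag i + fdiag j) * g = g.
  have ij : i != j by rewrite eq_sym.
  rewrite eg /fdiag -psiD; [|exact: projE|exact: projE|exact: EM0].
  apply/psi_le => //; first by apply: projD => //; [exact: projE|exact: projE|exact: EM0].
  rewrite Pz mulrA; congr (_ * _).
  rewrite /w /graph_col mulrDr !mulrDl EM EM0 1?eq_sym // /ediag muM0 // muM.
  by have [_ -> _] := ha; rewrite addr0 add0r.
have [x ex] : exists x, x = fdiag i * g by eexists.
have Bx : B x by rewrite ex; apply: (subM sB).
have xg : x * g = x by rewrite ex -mulrA gg.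
have fx : fdiag i * x = x by rewrite ex mulrA ff.
have [y By [h1 h2 h3 h4]] := rB Bx.
(* The defect is [psi t] with [t] below [ediag i] and orthogonal to [P]. Then [t * w = 0] says
   [t = - t * mu a j i], which vanishes since [t = t * ediag i]. *)
have xy : x * y = fdiag i.
  have ps : proj B (fdiag i - x * y).
    apply: projB => //; first by split => //; [apply: (subM sB) | rewrite mulrA h1].
    by rewrite mulrA fx.
  have [t pt et] := psi_surj ps.
  have sx : psi t * x = 0 by rewrite et mulrBl fx h1 subrr.
  have sfi : psi t * fdiag i = psi t.
    have xyf : x * y * fdiag i = x * y by rewrite -{1}h3 -{1}sf -starM mulrA fx h3.
    by rewrite et mulrBl ff xyf.
  have tP : t * P = 0 by apply/psiO => //; rewrite -eg -sfi -mulrA -ex.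
  have tw : t * w = 0 by rewrite -Pw mulrA tP mul0r.
  have tE : t * ediag i = t.
    apply: (proj_leC pt (projE i)); apply/(psi_le pt (projE i)).
    exact: (proj_geC (psiP pt) (projf i)).
  have t0 : t = 0.
    by rewrite -tE -{1}[ediag i](addrK (mu a j i)) -/w mulrBr tw -{1}tE /ediag -!mulrA muM0 1?eq_sym // mulr0 subrr.
  by apply/eqP; rewrite eq_sym -subr_eq0 -et t0 psi0.
(* Now [t] lies below [P] and is orthogonal to [ediag i]. Anything in the range of [w] is recovered
   from its row [i], so [t = w * (ediag i * t) = 0]. *)
have yx : y * x = g.
  have gyx : g * (y * x) = y * x by rewrite -h4 starM ex starM sf sg !mulrA gg.
  have ps : proj B (g - y * x).
    apply: projB => //; split => //; [exact: (subM sB) | by rewrite mulrA h2].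
  have [t pt et] := psi_surj ps.
  have xs : x * psi t = 0 by rewrite et mulrBr xg mulrA h1 subrr.
  have gs : g * psi t = psi t by rewrite et mulrBr gg gyx.
  have fs : fdiag i * psi t = 0 by rewrite -gs mulrA -ex.
  have Et : ediag i * t = 0 by apply/psiO => //; exact: projE.
  have Pt : P * t = t by apply/psi_le => //; rewrite -eg.
  have t0 : t = 0.
    have e1 : w * (ediag i * (z * t)) = t by rewrite mulrA wE mulrA -Pz.
    have e2 : ediag i * t = ediag i * (z * t) by rewrite -{1}e1 mulrA Ew mulrA EM.
    by rewrite -e1 -e2 Et mulr0.
  by apply/eqP; rewrite eq_sym -subr_eq0 -et t0 psi0.
have gy : g * y = y by rewrite -yx h2.
have fy : fdiag i * y = fdiag i by rewrite -[RHS]xy ex -mulrA gy.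
have yf : y * fdiag i = y by rewrite -xy mulrA h2.
have ey : fdiag i + fdiag j * y = y by rewrite -{1}fy -mulrDl -{1}gy mulrA fgg gy.
exists (fdiag j * y); split.
- by apply: (subM sB) => //; case: (projf j).
- by rewrite mulrA fM.
- by rewrite -mulrA yf.
- move=> P' /(range_proj_unique hP) <-; rewrite -eg ey; split=> //.
  by exists x.
Qed.

Definition slope j i a : T := epsilon (inhabits 0) (graph j i a).

Lemma slopeP j i a : j != i -> Ae a -> graph j i a (slope j i a).
Proof. by move=> ji ha; apply: epsilon_spec; apply: graph_exists. Qed.
Lemma slopeB j i a : j != i -> Ae a -> B (slope j i a). Proof. by move=> ji /(slopeP ji)[]. Qed.
Lemma fdiag_slope j i a : j != i -> Ae a -> fdiag j * slope j i a = slope j i a. Proof. by move=> ji /(slopeP ji)[]. Qed.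
Lemma slopef j i a : j != i -> Ae a -> slope j i a * fdiag i = slope j i a. Proof. by move=> ji /(slopeP ji)[]. Qed.
Lemma fdiag_slope0 k j i a : j != i -> k != j -> Ae a -> fdiag k * slope j i a = 0.
Proof. by move=> ji kj ha; rewrite -fdiag_slope // mulrA fM0 // mul0r. Qed.
Lemma slope_slope0 i j k l a b : i != j -> k != l -> j != k -> Ae a -> Ae b ->
  slope i j a * slope k l b = 0.
Proof. by move=> ij kl jk ha hb; rewrite -slopef // -mulrA fdiag_slope0 // mulr0. Qed.

(** The two-row case of the orthogonality relation uses only the defining property of slopes. It
    comes first because [column_le] tests longer columns against two-row ones. *)
Lemma slope_orth i j a b : i != j -> Ae a -> Ae b -> b + star a = 0 ->
  slope i j b + star (slope j i a) = 0.
Proof.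
move=> ij ha hb o; have ji : j != i by rewrite eq_sym.
have [P hP] := pivot_range (pivot_vec ji ha); have [Q hQ] := pivot_range (pivot_vec ij hb).
have [[_ _ _ /(_ _ hP) rP] [_ _ _ /(_ _ hQ) rQ]] := (slopeP ji ha, slopeP ij hb).
have : star (graph_col j i a) * graph_col i j b = 0.
  rewrite /graph_col starD mulrDl !mulrDr !mu_star !muM !muM0 // add0r addr0.
  have [_ _ ->] := pe; have [_ -> _] := hb; have [_ _ ->] := cornerS ha.
  by rewrite -muD o mu0.
move/(range_proj_orth hP hQ)/psiO => o'.
have /(range_proj_orth rP rQ) <- : psi P * psi Q = 0 by apply: o'; [case: hP | case: hQ].
have e1 : star (slope j i a) * fdiag j = star (slope j i a) by rewrite -{1}(fS j) -starM fdiag_slope.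
rewrite starD mulrDl !mulrDr fS fM0 // fdiag_slope // add0r e1.
by rewrite -[X in _ = _ + (_ + X * _)]e1 -mulrA fdiag_slope0 1?eq_sym // mulr0 addr0.
Qed.

Lemma slope_star_opp i j a : i != j -> Ae a -> slope i j (- star a) = - star (slope j i a).
Proof.
move=> ij ha; apply/eqP; rewrite -addr_eq0; apply/eqP; apply: slope_orth => //.
  exact/cornerN/cornerS.
by rewrite addrC subrr.
Qed.


Lemma proj_muc c i : proj A c -> proj M (mu c i i).
Proof. exact: proj_mu. Qed.

Lemma f_psi_mu c i : proj A c -> e * c = c -> fdiag i * psi (mu c i i) = psi (mu c i i).
Proof.
move=> pc ec; apply/psi_le; [exact: proj_muc | exact: projE |].
by rewrite muM ec.
Qed.

Lemma psi_mu_f c i : proj A c -> e * c = c -> psi (mu c i i) * fdiag i = psi (mu c i i).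
Proof.
move=> pc ec; apply: (proj_leC (psiP (proj_muc i pc)) (projf i)).
exact: f_psi_mu.
Qed.

Lemma proj_corner_compl c : proj A c -> e * c = c ->
  [/\ proj A (e - c), e * (e - c) = e - c & Ae c].
Proof.
move=> pc ec; have ce := proj_leC pc pe ec.
split; [exact: projB | by case: pe => _ ee _; rewrite mulrBr ee ec |].
by case: pc.
Qed.

Lemma psi_mu_compl c i : proj A c -> e * c = c ->
  psi (mu (e - c) i i) = fdiag i - psi (mu c i i).
Proof.
move=> pc ec; rewrite muD muN -/(ediag i) psiB //; [exact: proj_muc | exact: projE |].
by rewrite muM ec.
Qed.

Lemma psi_unit_ge i : psi (e%:M : 'M[L]_n) * fdiag i = fdiag i.
Proof.
apply/psi_le; [exact: projE | exact: proj_scalar_mx |].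
have [_ ee _] := pe; apply/matrixP => k l; rewrite scalar_mx_mull muE.
by case: ifP => _; rewrite ?ee ?mulr0.
Qed.

(** The expected image of a reduced column, put together from slopes while no homomorphism is
    available; [Phi_pivot] later identifies it with [Phi w]. *)
Definition column i c w : T := psi (mu c i i) + \sum_(j | j != i) slope j i (w @[j, i]).

(* The range projection of [column i c w] is the image of some projection [s]; orthogonality to the
   images of the columns orthogonal to [w] forces [s = w * s], that is, [s <= P]. *)
Lemma column_le i c w P : pivot i c w ->
  (forall j, j != i -> slope j i (w @[j, i]) * psi (mu c i i) = slope j i (w @[j, i])) ->
  range_proj M P w -> psi P * column i c w = column i c w.
Proof.
move=> hw hc [pP Pw [z Pz]]; have [Mw pc ec wc Ew] := hw.
have hA j : Ae (w @[j, i]) by exact: Mw.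
have pcc := proj_muc i pc; have [Bc _ _] := psiP pcc.
set W := column i c w.
have BW : B W.
  apply: (subD sB) => //; apply: sub_sum => // j ji; exact: slopeB.
have [l hl [y By ly]] := range_regular BW; have [pl lW _] := hl.
have [s ps es] := psi_surj pl.
have F1 : psi (e%:M : 'M[L]_n) * W = W.
  rewrite /W /column mulrDr; congr (_ + _).
    by rewrite -f_psi_mu // mulrA psi_unit_ge.
  by rewrite mulr_sumr; apply: eq_bigr => j ji; rewrite -fdiag_slope // mulrA psi_unit_ge.
have es1 : (e%:M : 'M[L]_n) * s = s.
  apply/psi_le => //; first exact: proj_scalar_mx.
  by rewrite es ly mulrA F1.
have sE j k : e * s @[j, k] = s @[j, k] by rewrite -scalar_mx_mull es1.
(* The test column has [e] in row [j] and [- star (w @[j, i])] in row [i]. It is orthogonal to [w],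
   its image is orthogonal to [W] by [slope_star_opp], and orthogonality to [s] is the claim. *)
have orth j k : j != i -> s @[j, k] = w @[j, i] * s @[i, k].
  move=> ji; have ij : i != j by rewrite eq_sym.
  have hv := pivot_vec ij (cornerN (cornerS (hA j))).
  have [Q hQ] := pivot_range hv; have [pQ Qv _] := hQ.
  have [_ _ _ /(_ _ hQ) rQ] := slopeP ij (cornerN (cornerS (hA j))).
  have o : star (fdiag j + slope i j (- star (w @[j, i]))) * W = 0.
    rewrite slope_star_opp // starD fS starN starK mulrBl /W /column !mulrDr.
    rewrite -[psi (mu c i i)]f_psi_mu // mulrA fM0 // mul0r add0r.
    rewrite f_psi_mu // hc // !mulr_sumr (bigD1 j) //= big1 ?addr0; last first.
      by move=> m /andP[mi mj]; rewrite fdiag_slope0 // eq_sym.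
    rewrite fdiag_slope // big1 ?addr0 ?subrr // => m mi.
    by rewrite slope_slope0 // eq_sym.
  have := (range_proj_orth rQ hl).1 o; rewrite -es => /(psiO pQ ps) Qs.
  have : star (graph_col i j (- star (w @[j, i]))) * s = 0.
    have [_ _ sQ] := pQ.
    by rewrite -Qv starM sQ -mulrA Qs mulr0.
  rewrite /graph_col starD !mu_star starN starK mulrDl => /matrixP/(_ j k).
  rewrite mxE !mu_mull eqxx mxE mulNr; have [_ _ ->] := pe.
  by rewrite sE => /eqP; rewrite subr_eq0 => /eqP.
(* Here the test projection is the part [e - c] of row [i] outside the pivot. *)
have orthi k : c * s @[i, k] = s @[i, k].
  have [pec eec _] := proj_corner_compl pc ec.
  have o : psi (mu (e - c) i i) * W = 0.
    rewrite psi_mu_compl // /W /column mulrDr mulrBl f_psi_mu //.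
    have [_ -> _] := psiP pcc; rewrite subrr add0r mulr_sumr big1 // => j ji.
    have ij : i != j by rewrite eq_sym.
    rewrite mulrBl fdiag_slope0 // -psi_mu_f // -mulrA fdiag_slope0 //.
    by rewrite mulr0 subrr.
  have := range_proj_le hl o; rewrite -es => /(psiO (proj_muc i pec) ps).
  move=> /matrixP/(_ i k); rewrite mu_mull eqxx mxE mulrBl sE.
  by move/eqP; rewrite subr_eq0 => /eqP.
have sw : s = w * s.
  apply/matrixP => j k; rewrite mxE (bigD1 i) //= big1 ?addr0 => [|m mi].
    by case: (eqVneq j i) => [->|ji]; [rewrite (pivot_row hw) orthi | rewrite orth].
  by rewrite (pivot_col j m hw) (negPf mi) mul0r.
have Ps : P * s = s by rewrite sw mulrA Pw.
have := (psi_le ps pP).1 Ps; rewrite es => Pl.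
by rewrite -lW mulrA Pl.
Qed.

(** As [a * c = 0], the column fixes [mu c i i], which therefore lies below [P]. In the range of
    [psi P] the [fdiag j] component is the slope applied to the [fdiag i] component; for
    [psi (mu c i i)], contained in [fdiag i], it is zero. *)
Lemma slope_psi_compl j i a c : j != i -> Ae a -> proj A c -> e * c = c -> a * c = 0 ->
  slope j i a * psi (mu c i i) = 0.
Proof.
move=> ji ha pc ec ac; have hw := pivot_vec ji ha; have [P hP] := pivot_range hw.
have [_ _ _ /(_ _ hP)] := slopeP ji ha; have [pP Pw _] := hP.
have Pc : P * mu c i i = mu c i i.
  have <- : graph_col j i a * mu c i i = mu c i i.
    by rewrite /graph_col mulrDl !muM ec ac mu0 addr0.
  by rewrite mulrA Pw.
have := (psi_le (proj_muc i pc) pP).1 Pc => Pf [_ Pg [z Pz]].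
have fz : fdiag i * (z * psi (mu c i i)) = psi (mu c i i).
  have : fdiag i * (psi P * psi (mu c i i)) = psi (mu c i i) by rewrite Pf f_psi_mu.
  have ij : i != j by rewrite eq_sym.
  rewrite Pz -mulrA mulrDl mulrDr mulrA fM [fdiag i * (slope _ _ _ * _)]mulrA fdiag_slope0 //.
  by rewrite mul0r addr0.
have : psi P * psi (mu c i i) = psi (mu c i i) + slope j i a * psi (mu c i i).
  by rewrite Pz -mulrA mulrDl fz -[X in X * (z * _)](slopef ji ha) -mulrA fz.
by rewrite Pf => /eqP; rewrite -{1}[psi _]addr0 (inj_eq (addrI _)) eq_sym => /eqP.
Qed.

Lemma slope_psi j i a c : j != i -> Ae a -> proj A c -> e * c = c -> a * c = a ->
  slope j i a * psi (mu c i i) = slope j i a.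
Proof.
move=> ji ha pc ec ac; have [pec eec _] := proj_corner_compl pc ec.
have : slope j i a * psi (mu (e - c) i i) = 0.
  by apply: slope_psi_compl => //; rewrite mulrBr ac; have [_ _ ->] := ha; rewrite subrr.
rewrite psi_mu_compl // mulrBr slopef // => /eqP.
by rewrite subr_eq0 => /eqP <-.
Qed.

Lemma slope0 j i : j != i -> slope j i 0 = 0.
Proof.
move=> ji; have [_ ee _] := pe; rewrite -(slopef ji corner0).
by apply: slope_psi_compl; rewrite ?mul0r //; exact: corner0.
Qed.

Lemma column2 i j k a b : j != i -> k != i -> j != k -> Ae a -> Ae b ->
  column i e (ediag i + mu a j i + mu b k i) = fdiag i + (slope j i a + slope k i b).
Proof.
move=> ji ki jk ha hb; rewrite /column -/(ediag i) -/(fdiag i); congr (_ + _).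
have kj : k != j by rewrite eq_sym.
rewrite (bigD1 j) //= (bigD1 k) ?ki //= big1 ?addr0; last first.
  move=> l /andP[/andP[li lj] lk].
  by rewrite !mxE (negPf li) (negPf lj) (negPf lk) /= !addr0 slope0.
congr (slope _ _ _ + slope _ _ _).
  by rewrite !mxE (negPf ji) (negPf jk) !eqxx /= addr0 add0r.
by rewrite !mxE (negPf ki) (negPf kj) !eqxx /= !add0r.
Qed.

Lemma slopeSf i j a : i != j -> Ae a -> star (slope i j a) * fdiag i = star (slope i j a).
Proof. by move=> ij ha; rewrite -{1}fS -starM fdiag_slope. Qed.

Lemma slopeS0 i j a x : i != j -> Ae a -> fdiag i * x = 0 -> star (slope i j a) * x = 0.
Proof. by move=> ij ha fx; rewrite -slopeSf // -mulrA fx mulr0. Qed.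

(** By [column_le] the image columns lie below [psi P] and [psi Q] and inherit their orthogonality.
    Of the nine products only the three with matching rows survive. *)
Lemma slope_orth2 i j k a b c d : i != j -> i != k -> j != k -> Ae a -> Ae b -> Ae c -> Ae d ->
  d + star a + star b * c = 0 ->
  slope i j d + star (slope j i a) + star (slope k i b) * slope k j c = 0.
Proof.
move=> ij ik jk ha hb hc hd o.
have [ji ki kj] : [/\ j != i, k != i & k != j] by split; rewrite eq_sym.
have hw := pivot_add ki (pivot_add ji (pivotE i) ha) hb.
have hv := pivot_add kj (pivot_add ij (pivotE j) hd) hc.
have [P hP] := pivot_range hw; have [Q hQ] := pivot_range hv.
have [[pP _ _] [pQ _ _]] := (hP, hQ).
have CP : psi P * (fdiag i + (slope j i a + slope k i b)) = fdiag i + (slope j i a + slope k i b).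
  rewrite -column2 //; apply: (column_le hw) hP => l li; rewrite -/(ediag i) slopef //.
  by case: hw.
have CQ : psi Q * (fdiag j + (slope i j d + slope k j c)) = fdiag j + (slope i j d + slope k j c).
  rewrite -column2 //; apply: (column_le hv) hQ => l lj; rewrite -/(ediag j) slopef //.
  by case: hv.
have [_ _ sP] := psiP pP.
have /(range_proj_orth hP hQ)/(psiO pP pQ) PQ :
    star (ediag i + mu a j i + mu b k i) * (ediag j + mu d i j + mu c k j) = 0.
  rewrite !starD !mulrDl !mulrDr !mu_star !muM !muM0 // !addr0 !add0r.
  have [_ _ ->] := pe; have [_ -> _] := hd; have [_ _ ->] := cornerS ha.
  by rewrite -!muD o mu0.
have : star (fdiag i + (slope j i a + slope k i b)) * (fdiag j + (slope i j d + slope k j c)) = 0.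
  by rewrite -CP -CQ starM sP -mulrA [psi P * _]mulrA PQ mul0r mulr0.
rewrite !starD fS !mulrDl !mulrDr fM0 // fdiag_slope // fdiag_slope0 // slopeSf //.
rewrite (slopeS0 (x := slope i j d)) ?fdiag_slope0 // (slopeS0 (x := slope k j c)) ?fdiag_slope0 //.
rewrite (slopeS0 (x := fdiag j)) ?fM0 // (slopeS0 (x := slope i j d)) ?fdiag_slope0 //.
by rewrite !addr0 !add0r addrA.
Qed.

Lemma slopeSE i j a : i != j -> Ae a -> star (slope i j a) = - slope j i (- star a).
Proof. by move=> ij ha; rewrite slope_star_opp ?opprK // eq_sym. Qed.

(** Solve the orthogonality relation for [d]. Both operations come from this one identity: [c = e]
    yields additivity and [a = 0] multiplicativity. *)
Lemma slope_affine i j k a b c : i != j -> i != k -> j != k -> Ae a -> Ae b -> Ae c ->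
  slope j i (a + star c * b) = slope j i a + star (slope k j c) * slope k i b.
Proof.
move=> ij ik jk ha hb hc.
have [ji kj] : j != i /\ k != j by split; rewrite eq_sym.
have hx : Ae (a + star c * b) by apply: cornerD => //; apply: cornerM => //; exact: cornerS.
have o : - star (a + star c * b) + star a + star b * c = 0.
  by rewrite starD starM starK opprD addrAC subrK addNr.
have := slope_orth2 ij ik jk ha hb hc (cornerN (cornerS hx)) o.
rewrite slope_star_opp // -addrA => /eqP; rewrite addrC subr_eq0 => /eqP h.
by rewrite -[LHS]starK -h starD starM !starK.
Qed.

(** * Ring operations on slopes and matrix entries *)

Hypothesis n3 : (3 <= n)%N.

Lemma third i j : exists2 k, k != i & k != j.
Proof.
have : (0 < #|[set~ i] :\ j|)%N.
  have h := cardsC1 i; rewrite card_ord in h.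
  have := cardsD1 j [set~ i]; rewrite h => h'.
  have : (2 <= n.-1)%N by case: n n3 => // -[|[|m]].
  by rewrite h'; case: (j \in _) => //=; rewrite add0n => /ltnW.
by case/card_gt0P => k; rewrite !inE => /andP[kj ki]; exists k.
Qed.

Lemma star_e : star e = e. Proof. by case: pe. Qed.
Lemma e_mul a : Ae a -> e * a = a. Proof. by case. Qed.
Lemma mul_e a : Ae a -> a * e = a. Proof. by case. Qed.

Lemma slopeD j i a b : j != i -> Ae a -> Ae b -> slope j i (a + b) = slope j i a + slope j i b.
Proof.
move=> ji ha hb; have [k ki kj] := third i j.
have [ij [ik jk]] : i != j /\ i != k /\ j != k by do !split; rewrite eq_sym.
have h a' : Ae a' -> slope j i (a' + b) = slope j i a' + star (slope k j e) * slope k i b.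
  move=> ha'; have := slope_affine ij ik jk ha' hb corner_e.
  by rewrite star_e (e_mul hb).
have := h _ corner0; rewrite add0r slope0 // add0r => h0.
by rewrite h // -h0.
Qed.

Lemma slopeN j i a : j != i -> Ae a -> slope j i (- a) = - slope j i a.
Proof.
move=> ji ha; apply/eqP; rewrite -addr_eq0 -slopeD //; last exact: cornerN.
by rewrite addNr slope0.
Qed.

Lemma slopeS i j a : i != j -> Ae a -> star (slope i j a) = slope j i (star a).
Proof.
move=> ij ha; have ji : j != i by rewrite eq_sym.
rewrite slopeSE // slopeN ?opprK //; exact: cornerS.
Qed.

Lemma slopeM i j k a b : i != j -> i != k -> j != k -> Ae a -> Ae b ->
  slope i j a * slope j k b = slope i k (a * b).
Proof.
move=> ij ik jk ha hb.
have [ki [kj ji]] : k != i /\ k != j /\ j != i by do !split; rewrite eq_sym.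
have := slope_affine ki kj ij corner0 hb (cornerS ha).
by rewrite starK !add0r slope0 // add0r slopeS ?starK //; exact: cornerS.
Qed.

(** [slopeM] covers only distinct outer indices. The columns [graph_col i j e] and [graph_col j i e]
    differ by a matrix unit on the right, so they share [P]; the two descriptions of [psi P],
    compared row by row, give the product. *)
Lemma slope_inv i j : i != j -> slope i j e * slope j i e = fdiag i.
Proof.
move=> ij; have ji : j != i by rewrite eq_sym.
have [P hP] := pivot_range (pivot_vec ij corner_e); have [pP Pw [z Pz]] := hP.
have ee : e * e = e by case: pe.
have hP' : range_proj M P (graph_col j i e).
  have e1 : graph_col j i e = graph_col i j e * mu e j i.
    by rewrite /graph_col mulrDl !muM ee addrC.
  have e2 : graph_col i j e = graph_col j i e * mu e i j.
    by rewrite /graph_col mulrDl !muM ee addrC.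
  split=> //; first by rewrite e1 mulrA Pw.
  by exists (mu e i j * z); rewrite mulrA -e2.
have [_ _ _ /(_ _ hP)[_ _ [y Py]]] := slopeP ij corner_e.
have [_ _ _ /(_ _ hP')[_ hv _]] := slopeP ji corner_e.
have he := corner_e.
have kj Y : fdiag j * (psi P * Y) = fdiag j * (y * Y).
  by rewrite Py -mulrA mulrA mulrDr fM fdiag_slope0 ?addr0.
have ki Y : fdiag i * (psi P * Y) = slope i j e * (y * Y).
  by rewrite Py -mulrA mulrA mulrDr fM0 // add0r fdiag_slope.
have e3 : fdiag j * (y * (fdiag i + slope j i e)) = slope j i e.
  by rewrite -kj hv mulrDr fM0 // fdiag_slope ?add0r.
rewrite -[in LHS]e3 mulrA slopef // -ki.
by rewrite hv mulrDr fM fdiag_slope0 ?addr0 //; exact: corner_e.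
Qed.

(** There is no slope from a row to itself, so a diagonal entry makes a detour through another row.
    The default [i] of [odflt] would be reached only for [n = 1]. *)
Definition ent i j a : T :=
  if i == j then let k := odflt i [pick k | k != i] in slope i k e * slope k i a else slope i j a.

Lemma ent_slope i j a : i != j -> ent i j a = slope i j a.
Proof. by rewrite /ent => /negPf ->. Qed.

Lemma ent_diag i k a : k != i -> Ae a -> ent i i a = slope i k e * slope k i a.
Proof.
move=> ki ha; rewrite /ent eqxx; case: pickP => [l li /=|/(_ k)]; last by rewrite ki.
case: (eqVneq l k) => [-> //|lk].
have [ik [il kl]] : i != k /\ i != l /\ k != l by do !split; rewrite eq_sym.
have he := corner_e; have ee := mul_e he.
rewrite -[in RHS](e_mul ha) -(@slopeM k l i) //.
by rewrite mulrA (@slopeM i k l) // ee.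
Qed.

(** Coinciding indices are separated by inserting an extra row, after which [slopeM] applies; the
    case [i = j = k] takes two extra rows. *)
Lemma entM i j k a b : Ae a -> Ae b -> ent i j a * ent j k b = ent i k (a * b).
Proof.
move=> ha hb; have hab := cornerM ha hb; have he := corner_e.
have sy (x y : 'I_n) : x != y -> y != x by rewrite eq_sym.
case: (eqVneq i j) => [<-|ij].
  have [l li lk] := third i k; have [il kl] := (sy _ _ li, sy _ _ lk).
  rewrite (ent_diag li ha); case: (eqVneq i k) => [ik|ik].
    rewrite -ik in lk kl *; have [m mi ml] := third i l.
    have [im lm] := (sy _ _ mi, sy _ _ ml).
    rewrite (ent_diag mi hb) (ent_diag li hab) -!mulrA; congr (_ * _).
    by rewrite mulrA (@slopeM l i m) // (mul_e ha) (@slopeM l m i).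
  by rewrite !ent_slope // -mulrA (@slopeM l i k) // (@slopeM i l k) // (e_mul hab).
have ji := sy _ _ ij; rewrite ent_slope //.
case: (eqVneq j k) => [<-|jk].
  have [l lj li] := third j i; have [jl il] := (sy _ _ lj, sy _ _ li).
  by rewrite (ent_diag lj hb) ent_slope // mulrA (@slopeM i j l) // (mul_e ha) (@slopeM i l j).
rewrite ent_slope //; case: (eqVneq i k) => [ik|ik]; last by rewrite ent_slope // slopeM.
rewrite -ik in jk *; have [l li lj] := third i j; have [il jl] := (sy _ _ li, sy _ _ lj).
by rewrite (ent_diag li hab) -(@slopeM l j i) // mulrA (@slopeM i l j) // (e_mul ha).
Qed.

Lemma entD i j a b : Ae a -> Ae b -> ent i j (a + b) = ent i j a + ent i j b.
Proof.
move=> ha hb; case: (eqVneq i j) => [<-|ij]; last by rewrite !ent_slope // slopeD.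
have [k ki _] := third i i; rewrite !(ent_diag ki) ?slopeD ?mulrDr //; exact: cornerD.
Qed.

Lemma entS i j a : Ae a -> star (ent i j a) = ent j i (star a).
Proof.
move=> ha; have he := corner_e; case: (eqVneq i j) => [<-|ij]; last first.
  by rewrite !ent_slope ?slopeS // eq_sym.
have [k ki _] := third i i; have ik : i != k by rewrite eq_sym.
rewrite (ent_diag ki ha) starM !slopeS // star_e -!ent_slope // entM ?(mul_e (cornerS ha)) //.
exact: cornerS.
Qed.

Lemma entB i j a : Ae a -> B (ent i j a).
Proof.
move=> ha; case: (eqVneq i j) => [<-|ij]; last by rewrite ent_slope //; exact: slopeB.
have [k ki _] := third i i; rewrite (ent_diag ki ha).
by apply: (subM sB); apply: slopeB => //; rewrite 1?eq_sym //; exact: corner_e.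
Qed.

Lemma ent_e i : ent i i e = fdiag i.
Proof.
have [k ki _] := third i i; rewrite (ent_diag ki corner_e) slope_inv //.
by rewrite eq_sym.
Qed.

Lemma fdiag_ent i j a : Ae a -> fdiag i * ent i j a = ent i j a.
Proof. by move=> ha; rewrite -ent_e entM ?(e_mul ha) //; exact: corner_e. Qed.
Lemma entf i j a : Ae a -> ent i j a * fdiag j = ent i j a.
Proof. by move=> ha; rewrite -ent_e entM ?(mul_e ha) //; exact: corner_e. Qed.
Lemma ent_ent0 i j k l a b : j != k -> Ae a -> Ae b -> ent i j a * ent k l b = 0.
Proof. by move=> jk ha hb; rewrite -entf // -(fdiag_ent k l hb) -mulrA [fdiag j * _]mulrA fM0 // mul0r mulr0. Qed.

Lemma ent0 i j : ent i j 0 = 0.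
Proof.
by apply: (addrI (ent i j 0)); rewrite -entD ?addr0 //; exact: corner0.
Qed.

(** [slope k i (e - c)] annihilates [psi (mu c i i)], so on this projection [slope k i c] acts as
    [slope k i e], and [slope_inv] cancels the detour. *)
Lemma ent_psi i c : proj A c -> e * c = c -> ent i i c = psi (mu c i i).
Proof.
move=> pc ec; have [pec eec hc] := proj_corner_compl pc ec.
have [_ _ hec] := proj_corner_compl pec eec; have he := corner_e.
have [k ki _] := third i i; have ik : i != k by rewrite eq_sym.
rewrite (ent_diag ki hc) -(slope_psi ki hc pc ec); last by case: pc.
have -> : slope k i c * psi (mu c i i) = slope k i e * psi (mu c i i).
  rewrite -[in RHS](subrK c e) slopeD // mulrDl (slope_psi_compl ki hec pc ec) ?add0r //.
  by rewrite mulrBl ec; case: pc => _ ->; rewrite subrr.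
by rewrite mulrA slope_inv // f_psi_mu.
Qed.

(** A vanishing slope gives [psi P = psi (ediag l)], so [P = ediag l] by injectivity of [psi], and
    the column has no second entry. *)
Lemma ent_inj i j a : Ae a -> ent i j a = 0 -> a = 0.
Proof.
have main k l : k != l -> Ae a -> slope k l a = 0 -> a = 0.
  move=> kl ha a0; have [P hP] := pivot_range (pivot_vec kl ha); have [pP Pw _] := hP.
  have [_ _ _ /(_ _ hP)] := slopeP kl ha; rewrite a0 addr0 => h.
  have e1 : psi P = psi (ediag l).
    by apply: (range_proj_unique h); split; [exact: projf | exact: fM | exists (fdiag l); rewrite fM].
  have PE : P = ediag l := orthoiso_inj sM sB luM luB psiP psi_surj psiO pP (projE l) e1.
  move: Pw; rewrite PE /graph_col mulrDr EM muM0 1?eq_sym // addr0 => /matrixP/(_ k l).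
  by rewrite !mxE (negPf kl) !eqxx /= add0r => <-.
move=> ha; case: (eqVneq i j) => [<-|ij]; last by rewrite ent_slope //; exact: main.
have [k ki _] := third i i => h; apply: (main k i) => //.
by rewrite -ent_slope // -[a](e_mul ha) -(entM k i i corner_e ha) h mulr0.
Qed.

(** * The ring homomorphism on the matrices over a corner *)

Definition Phi w : T := \sum_i \sum_j ent i j (w @[i, j]).
Local Notation Me := (mat_sub Ae).

Lemma PhiB w : Me w -> B (Phi w).
Proof. by move=> hw; do 2![apply: sub_sum => // ? _]; exact: entB. Qed.
Lemma PhiD w v : Me w -> Me v -> Phi (w + v) = Phi w + Phi v.
Proof.
move=> hw hv; rewrite /Phi -big_split; apply: eq_bigr => i _.
by rewrite -big_split; apply: eq_bigr => j _; rewrite mxE entD.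
Qed.
Lemma PhiS w : Me w -> Phi (star w) = star (Phi w).
Proof.
move=> hw; rewrite /Phi star_sum exchange_big; apply: eq_bigr => i _.
by rewrite star_sum; apply: eq_bigr => j _; rewrite mxE entS.
Qed.
Lemma ent_sum i j (F : 'I_n -> L) : (forall k, Ae (F k)) ->
  ent i j (\sum_k F k) = \sum_k ent i j (F k).
Proof.
move=> hF; suff [] : Ae (\sum_k F k) /\ ent i j (\sum_k F k) = \sum_k ent i j (F k) by [].
apply: (big_ind2 (fun a x => Ae a /\ ent i j a = x)) => [|a x b y [ha <-] [hb <-]|k _].
- by rewrite ent0; split => //; exact: corner0.
- by rewrite entD //; split => //; exact: cornerD.
- by [].
Qed.
Lemma PhiM w v : Me w -> Me v -> Phi (w * v) = Phi w * Phi v.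
Proof.
move=> hw hv; rewrite /Phi mulr_suml; apply: eq_bigr => i _.
transitivity (\sum_j \sum_k ent i k (w @[i, k]) * ent k j (v @[k, j])).
  apply: eq_bigr => j _; rewrite mxE ent_sum => [|k]; last exact: cornerM.
  by apply: eq_bigr => k _; rewrite entM.
rewrite exchange_big mulr_suml; apply: eq_bigr => k _; rewrite mulr_sumr.
rewrite [RHS](bigD1 k) //= [X in _ = _ + X]big1 ?addr0 => [|l lk].
  by rewrite mulr_sumr.
by rewrite mulr_sumr big1 // => j _; rewrite ent_ent0 // eq_sym.
Qed.
Lemma Phi_mu a i j : Phi (mu a i j) = ent i j a.
Proof.
rewrite /Phi (bigD1 i) //= (bigD1 j) //= muE !eqxx /= big1 => [|k kj]; last first.
  by rewrite muE (negPf kj) andbF ent0.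
rewrite big1 ?addr0 // => k ki; rewrite big1 // => l _.
by rewrite muE (negPf ki) ent0.
Qed.

Lemma fPhif i j w : Me w -> fdiag i * Phi w * fdiag j = ent i j (w @[i, j]).
Proof.
move=> hw; have he i' : mat_sub Ae (ediag i').
  by move=> k l; rewrite muE; case: ifP => _; [exact: corner_e | exact: corner0].
have M1 : Me (ediag i * w) by move=> k l; rewrite mu_mull; case: ifP => _; [rewrite e_mul | exact: corner0].
rewrite -!ent_e -!Phi_mu -!PhiM //.
have -> : ediag i * w * ediag j = mu (w @[i, j]) i j.
  apply/matrixP => k l; rewrite mu_mulr mu_mull muE.
  by case: eqP => _; case: eqP => _ //=; rewrite ?mul0r // (e_mul (hw _ _)) (mul_e (hw _ _)).
by rewrite Phi_mu.
- exact: he.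
- exact: he.
Qed.

Lemma corner_mu a i j : Ae a -> Me (mu a i j).
Proof. by move=> ha k l; rewrite muE; case: ifP => _ //; exact: corner0. Qed.
Lemma corner_mul w v : Me w -> Me v -> Me (w * v).
Proof.
move=> hx hy p q; rewrite mxE; apply: big_ind => [|? ? ? ?|k _].
- exact: corner0.
- exact: cornerD.
- exact: cornerM.
Qed.

Lemma Phi_inj w : Me w -> Phi w = 0 -> w = 0.
Proof.
move=> hw h; apply/matrixP => i j; rewrite mxE; apply: (@ent_inj i j _ (hw i j)).
by rewrite -(fPhif i j hw) h mulr0 mul0r.
Qed.

Lemma Phi_pivot i c w : pivot i c w -> Phi w = column i c w.
Proof.
move=> hw; have [Mw pc ec _ _] := hw.
have -> : Phi w = \sum_k ent k i (w @[k, i]).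
  apply: eq_bigr => k _; rewrite (bigD1 i) //= big1 ?addr0 // => l li.
  by rewrite (pivot_col k l hw) (negPf li) ent0.
rewrite (bigD1 i) //= (pivot_row hw) ent_psi //; congr (_ + _).
by apply: eq_bigr => j ji; rewrite ent_slope.
Qed.

Lemma pivot_le i c w P : pivot i c w -> range_proj M P w -> psi P * Phi w = Phi w.
Proof.
move=> hw hP; rewrite (Phi_pivot hw); apply: (column_le hw) => // j ji.
have [Mw pc ec _ _] := hw; apply: slope_psi => //.
by rewrite [RHS](pivot_col j i hw) eqxx.
Qed.

(* Column reduction: the right ideal [N] is generated by its reduced columns. *)
Lemma pivot_span (N Q : mat_staralg L n -> Prop) :
  (forall w v, N w -> N v -> N (w - v)) -> (forall w v, N w -> Me v -> N (w * v)) ->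
  (forall w v, Q w -> Q v -> Q (w + v)) -> (forall w v, Me w -> Q w -> Me v -> Q (w * v)) -> Q 0 ->
  (forall i c w, pivot i c w -> N w -> Q w) -> forall w, Me w -> N w -> Q w.
Proof.
move=> NB NM QD QM Q0 piv.
(* Induction on the number [m] of rows still to be cleared in column [l]: rows with index below
   [n - m] vanish already, so for [m.+1] the next pivot row is [n - m.+1]. *)
have col m : (m <= n)%N -> forall l w, Me w -> N w -> w * ediag l = w ->
    (forall i j, (i < n - m)%N -> w @[i, j] = 0) -> Q w.
  elim: m => [|m IH] mn l w Mw Nw wl w0.
    suff -> : w = 0 by [].
    by apply/matrixP => i j; rewrite w0 ?mxE // subn0.
  have im : (n - m.+1 < n)%N by rewrite ltn_subrL /= (leq_ltn_trans _ mn).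
  pose i := Ordinal im.
  have [Aa ea ae] := Mw i l; have [b' Ab' [h1' h2' h3' h4']] := rA Aa.
  set a := w @[i, l] in Aa ea ae h1' h2' h3' h4'.
  have [_ ee se] := pe.
  have eab : e * (a * b') = a * b' by rewrite mulrA ea.
  have bae : b' * a * e = b' * a by rewrite -mulrA ae.
  have abe : a * b' * e = a * b' by rewrite -{1}h3' -{1}se -starM eab h3'.
  have eba : e * (b' * a) = b' * a by rewrite -{1}h4' -{1}se -starM bae h4'.
  have hb : Ae b' by split=> //; [rewrite -[in LHS]h2' mulrA eba h2' | rewrite -[in LHS]h2' -!mulrA [a * (b' * e)]mulrA abe mulrA h2'].
  have ha : Ae a by [].
  (* Multiplying by the pseudo-inverse [b'] of the leading entry [a] makes the column reduced with
     pivot [c]. Multiplying back by [a] restores the leading entry [a * b' * a = a], so subtracting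
     the result clears the row. *)
  pose c := a * b'.
  have pc : proj A c by split; rewrite /c ?mulrA ?h1' //; exact: subM.
  pose v := w * mu b' l i.
  have pv : pivot i c v.
    split=> //; first by apply: corner_mul => //; exact: corner_mu.
      by rewrite /v -mulrA muM /c mulrA h2'.
    apply/matrixP => p q; rewrite mu_mull mu_mulr muE.
    by case: eqP => _; case: eqP => _ //=; rewrite ?mulr0 // -/a eab.
  have Nv : N v by apply: NM => //; exact: corner_mu.
  have Qv := piv _ _ _ pv Nv.
  pose v' := v * mu a i l.
  have Mv : Me v by case: pv.
  have Qv' : Q v' by apply: QM => //; exact: corner_mu.
  have Nv' : N v' by apply: NM => //; exact: corner_mu.
  rewrite -(subrK v' w); apply: QD => //.
  apply: (IH (ltnW mn) l) => //.
  - move=> p q; rewrite !mxE; apply: cornerD => //; apply: cornerN.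
    by have := corner_mul Mv (corner_mu i l ha) p q; rewrite mxE.
  - exact: NB.
  - by rewrite mulrBl wl /v' -mulrA muM ae.
  - move=> p q pm.
    have wq : w @[p, q] = if q == l then w @[p, l] * e else 0 by rewrite -[in LHS]wl mu_mulr.
    rewrite mxE [X in _ + X]mxE wq !mu_mulr eqxx; case: eqP => _; last by rewrite subr0.
    have := pm; rewrite leq_eqVlt; case/orP => [/eqP pm'|pm'].
      have -> : p = i by apply: val_inj => /=; rewrite subnS -pm'.
      by rewrite -/a ae h1' subrr.
    by rewrite (w0 p) ?mul0r ?subrr // subnS -ltnS prednK // subn_gt0.
move=> w Mw Nw.
have -> : w = \sum_l w * ediag l.
  apply/matrixP => p q; rewrite summxE (bigD1 q) //= mu_mulr eqxx mul_e // big1 ?addr0 // => l lq.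
  by rewrite mu_mulr eq_sym (negPf lq).
apply: big_ind => // l _; apply: (col n _ l) => //.
- by apply: corner_mul => //; exact/corner_mu/corner_e.
- by apply: NM => //; exact/corner_mu/corner_e.
- by rewrite -mulrA EM.
- by move=> i j; rewrite subnn.
Qed.

(** * Agreement of [Phi] and [psi] on projections *)

Lemma unit_mul w : Me w -> (e%:M : 'M[L]_n) * w = w.
Proof. by move=> hw; apply/matrixP => i j; rewrite scalar_mx_mull e_mul. Qed.
Lemma mul_unit w : Me w -> w * (e%:M : 'M[L]_n) = w.
Proof. by move=> hw; apply/matrixP => i j; rewrite scalar_mx_mulr mul_e. Qed.

Lemma corner_sub w : Me w -> M w.
Proof. by move=> hw i j; case: (hw i j). Qed.

Lemma proj_unit : proj M (e%:M : 'M[L]_n).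
Proof. exact: proj_scalar_mx. Qed.

Lemma corner_unit : Me (e%:M : 'M[L]_n).
Proof.
by move=> i j; rewrite mxE; case: eqP => _; [exact: corner_e | exact: corner0].
Qed.

Lemma PhiN w : Me w -> Phi (- w) = - Phi w.
Proof.
move=> hw; apply: (addrI (Phi w)); rewrite -PhiD ?subrr //.
  by rewrite /Phi big1 // => i _; rewrite big1 // => j _; rewrite mxE ent0.
by move=> i j; rewrite mxE; exact: cornerN.
Qed.

Lemma Phi0 : Phi 0 = 0.
Proof. by rewrite /Phi big1 // => i _; rewrite big1 // => j _; rewrite mxE ent0. Qed.

Lemma corner_matB w v : Me w -> Me v -> Me (w - v).
Proof. by move=> hw hv i j; rewrite !mxE; apply: cornerD => //; exact: cornerN. Qed.

(** The elements killed by [p] from the left form a right ideal, so [pivot_span] leaves only reduced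
    columns; there [Phi w] lies below [psi P], and [P] is orthogonal to [p]. *)
Lemma psi_Phi_orth p w : proj M p -> Me w -> p * w = 0 -> psi p * Phi w = 0.
Proof.
move=> pp Mw pw.
suff [] : Me w /\ psi p * Phi w = 0 by [].
move: w Mw pw; apply: (pivot_span (N := fun v => p * v = 0)).
- by move=> w v hw hv; rewrite mulrBr hw hv subrr.
- by move=> w v hw _; rewrite mulrA hw mul0r.
- move=> w v [Mw hw] [Mv hv]; split; last by rewrite PhiD // mulrDr hw hv addr0.
  by move=> i j; rewrite mxE; exact: cornerD.
- move=> w v _ [Mw hw] Mv; split; first exact: corner_mul.
  by rewrite PhiM // mulrA hw mul0r.
- by split; [move=> i j; rewrite mxE; exact: corner0 | rewrite Phi0 mulr0].
- move=> i c w hw pw; split; first by case: hw.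
  have [P hP] := pivot_range hw; have [pP _ _] := hP.
  have /(psiO pp pP) o := range_proj_le hP pw.
  by rewrite -(pivot_le hw hP) mulrA o mul0r.
Qed.

Lemma Phi_unit : Phi (e%:M : 'M[L]_n) = \sum_i fdiag i.
Proof.
apply: eq_bigr => i _; rewrite (bigD1 i) //= mxE eqxx mulr1n ent_e big1 ?addr0 // => j ji.
by rewrite mxE eq_sym (negPf ji) ent0.
Qed.

Lemma psi_unit_Phi w : Me w -> psi (e%:M : 'M[L]_n) * Phi w = Phi w.
Proof.
move=> hw; rewrite -[in LHS](unit_mul hw) PhiM //; last exact: corner_unit.
rewrite mulrA -[X in _ = X](congr1 Phi (unit_mul hw)) PhiM //; last exact: corner_unit.
congr (_ * _); rewrite Phi_unit mulr_sumr; apply: eq_bigr => i _.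
exact: psi_unit_ge.
Qed.

(** The left side is the sum of the [fdiag i] and lies below the right side. The gap is the image of
    a projection [t] below the unit that is orthogonal to every [ediag i], hence zero. *)
Lemma Phi_psi_unit : Phi (e%:M : 'M[L]_n) = psi (e%:M : 'M[L]_n).
Proof.
have cU := corner_unit; have pU := proj_unit; have [_ UU sU] := pU.
have pF : proj B (Phi (e%:M : 'M[L]_n)).
  split; [exact: PhiB | by rewrite -PhiM ?UU | by rewrite -PhiS ?sU].
have le := psi_unit_Phi cU.
have [t pt et] := psi_surj (projB sB pF (psiP pU) le).
have [_ FF _] := pF.
have tf i : psi t * fdiag i = 0.
  have Ff : Phi (e%:M : 'M[L]_n) * fdiag i = fdiag i.
    by rewrite -ent_e -Phi_mu -PhiM ?unit_mul //; exact/corner_mu/corner_e.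
  by rewrite et mulrBl Ff psi_unit_ge subrr.
have tE i : t * ediag i = 0 := (psiO pt (projE i)).2 (tf i).
have tU : t * (e%:M : 'M[L]_n) = t.
  apply: (proj_leC pt pU); apply/psi_le => //.
  have [_ pUU _] := psiP pU.
  by rewrite et mulrBr pUU le.
have t0 : t = 0.
  apply/matrixP => i j; rewrite -tU scalar_mx_mulr mxE.
  have := tE j => /matrixP/(_ i j); rewrite mu_mulr eqxx mxE => <-.
  by [].
by apply/eqP; rewrite eq_sym -subr_eq0 -et t0 psi0.
Qed.

(** Let [q] be the complement of [p] in the unit of the corner. [psi p * Phi q = 0] puts [psi p]
    below [Phi p], and [psi q * Phi p = 0] gives the converse. *)
Lemma Phi_psi p : proj M p -> Me p -> Phi p = psi p.
Proof.
move=> pp Mp; have pU := proj_unit; have cU := corner_unit.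
have Up := unit_mul Mp; have pq := projB sM pp pU Up; have cq := corner_matB cU Mp.
have [_ ppp _] := pp.
have h1 : psi p * Phi p = psi p.
  have := psi_Phi_orth pp cq; rewrite mulrBr mul_unit // ppp subrr => /(_ erefl).
  have -> : Phi ((e%:M : 'M[L]_n) - p) = Phi (e%:M : 'M[L]_n) - Phi p.
    by rewrite PhiD ?PhiN // => i j; rewrite mxE; exact: cornerN.
  rewrite Phi_psi_unit mulrBr => /eqP; rewrite subr_eq0 => /eqP <-.
  by apply: (proj_leC (psiP pp) (psiP pU)); apply/psi_le.
have := psi_Phi_orth pq Mp; rewrite mulrBl Up ppp subrr => /(_ erefl).
rewrite psiB // mulrBl h1 psi_unit_Phi // => /eqP.
by rewrite subr_eq0 => /eqP.
Qed.

Theorem coordinates : exists F : mat_staralg L n -> T,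
  [/\ (forall w, Me w -> B (F w)), (forall w v, Me w -> Me v -> F (w + v) = F w + F v),
      (forall w v, Me w -> Me v -> F (w * v) = F w * F v),
      (forall w, Me w -> F (star w) = star (F w)) &
      (forall w, Me w -> F w = 0 -> w = 0) /\ (forall p, proj M p -> Me p -> F p = psi p)].
Proof.
exists Phi; split; [exact: PhiB | exact: PhiD | exact: PhiM | exact: PhiS |].
by split; [exact: Phi_inj | exact: Phi_psi].
Qed.

End Coordinates.

(** * Complexification *)

Section RealImaginary.
Variables (C : numClosedFieldType) (L : staralg C).
Implicit Types x y w : L.

Definition sre x := scal L 2^-1 * (x + star x).
Definition sim x := scal L (- 'i / 2) * (x - star x).

Lemma scal_half x : scal L 2^-1 * (x + x) = x.
Proof.
rewrite -mulr2n -[x *+ 2]mulr_natl -scal_nat mulrA -scalM mulVf ?scal1 ?mul1r //.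
by rewrite pnatr_eq0.
Qed.

Lemma conj_half : (2^-1 : C)^* = 2^-1.
Proof. by apply: CrealP; rewrite realV realn. Qed.

Lemma star_sre x : star (sre x) = sre x.
Proof. by rewrite /sre starM starD starK star_scal conj_half -scalC addrC. Qed.

Lemma star_sim x : star (sim x) = sim x.
Proof.
rewrite /sim starM starB starK star_scal -scalC rmorphM rmorphN /= conjCi opprK conj_half.
by rewrite -opprB mulrN -mulNr -scalN mulNr.
Qed.

Lemma sre_sim x : sre x + scal L 'i * sim x = x.
Proof.
rewrite /sre /sim mulrA -scalM mulrA mulrN -expr2 sqrCi opprK mul1r -mulrDr.
by rewrite addrACA addrN addr0 scal_half.
Qed.

Lemma sre_unique x y : star x = x -> star y = y -> sre (x + scal L 'i * y) = x.
Proof.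
move=> sx sy; rewrite /sre starD starM sx sy star_scal conjCi scalN mulrN -scalC.
by rewrite addrACA addrN addr0 scal_half.
Qed.

Lemma sim_unique x y : star x = x -> star y = y -> sim (x + scal L 'i * y) = y.
Proof.
move=> sx sy; rewrite /sim starD starM sx sy star_scal conjCi scalN mulrN -scalC.
rewrite opprB addrC addrA subrK -mulrDr mulrA -scalM mulrAC mulNr -expr2 sqrCi opprK mul1r.
exact: scal_half.
Qed.

Lemma sre_subalg (X : L -> Prop) x : subalg X -> X x -> X (sre x).
Proof. by move=> sX Xx; apply: (subZ sX); apply: (subD sX) => //; apply: (subS sX). Qed.
Lemma sim_subalg (X : L -> Prop) x : subalg X -> X x -> X (sim x).
Proof. by move=> sX Xx; apply: (subZ sX); apply: subB => //; apply: (subS sX). Qed.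
End RealImaginary.

Definition archimedean (C : numClosedFieldType) :=
  forall x : C, 0 <= x -> exists m : nat, m%:R <= x < m.+1%:R.

(** An abstract form of operator positivity. The last clause excludes infinitesimals: [y] vanishes
    if all its multiples stay between [- x] and [x]. *)
Record positive_cone (C : numClosedFieldType) (T : staralg C) (pos : T -> Prop) : Prop := {
  pos_sq : forall x, pos (star x * x);
  posD : forall x y, pos x -> pos y -> pos (x + y);
  pos_arch : forall x y, (forall m, pos (x - y *+ m) /\ pos (x + y *+ m)) -> y = 0 }.

Section ComplexLinear.
Variables (C : numClosedFieldType) (S T : staralg C) (X : S -> Prop) (pos : T -> Prop).
Hypotheses (archC : archimedean C) (cone : positive_cone pos) (sX : subalg X).
Variables (u : S) (F : S -> T).
Hypotheses (pu : proj X u) (uX : forall x, X x -> u * x = x).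
Hypothesis FD : forall x y, X x -> X y -> F (x + y) = F x + F y.
Hypothesis FM : forall x y, X x -> X y -> F (x * y) = F x * F y.
Hypothesis FS : forall x, X x -> F (star x) = star (F x).

Lemma additive0 : F 0 = 0.
Proof. by apply: (addrI (F 0)); rewrite -FD ?addr0 //; exact: sub0. Qed.

(** The defect of linearity on multiples of the unit is additive and vanishes at 1, hence has period
    1. *)
Let D t := F (scal S t * u) - scal T t * F u.

Let Xu t : X (scal S t * u).
Proof. by apply: (subZ sX); case: pu. Qed.

Let DD s t : D (s + t) = D s + D t.
Proof.
rewrite /D !scalD !mulrDl FD //; rewrite opprD addrACA //.
Qed.

Let D1 : D 1 = 0.
Proof. by rewrite /D !scal1 !mul1r subrr. Qed.

Let Dmn t m : D (m%:R * t) = D t *+ m.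
Proof.
elim: m => [|m IH]; last by rewrite [RHS]mulrS -IH -natr1 mulrDl mul1r addrC DD.
by rewrite mul0r mulr0n /D !scal0 !mul0r additive0 subrr.
Qed.

Let sqrt_u r : 0 <= r -> scal S r * u = star (scal S (sqrtC r) * u) * (scal S (sqrtC r) * u).
Proof.
move=> r0; have [_ uu su] := pu.
have rr : (sqrtC r)^* = sqrtC r by apply: CrealP; rewrite ger0_real ?sqrtC_ge0.
by rewrite starM su star_scal rr -scalC scalMM -expr2 sqrtCK uu.
Qed.

Let pos_g r : 0 <= r -> pos (F (scal S r * u)).
Proof. by move=> r0; rewrite sqrt_u // FM ?FS //; [exact: (pos_sq cone) | exact: (subS sX)]. Qed.

Let pos_G r : 0 <= r -> pos (scal T r * F u).
Proof.
move=> r0; have [Xu1 uu su] := pu.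
have rr : (sqrtC r)^* = sqrtC r by apply: CrealP; rewrite ger0_real ?sqrtC_ge0.
have := pos_sq cone (scal T (sqrtC r) * F u).
by rewrite starM -FS // su star_scal rr -scalC scalMM -expr2 sqrtCK -FM // uu.
Qed.

(** For [s >= 0], periodicity gives [D s *+ m = D r] with [r] the fractional part of [m * s], and
    for [r] between 0 and 1 positivity places [D r] between [- F u] and [F u]. So all multiples of
    [D s] are bounded by [F u], which forces [D s = 0]. *)
Lemma real_unit_linear t : t \is Num.real -> F (scal S t * u) = scal T t * F u.
Proof.
have main s : 0 <= s -> D s = 0.
  move=> s0; apply: (pos_arch cone (x := F u)) => m.
  have ms0 : 0 <= m%:R * s by rewrite mulr_ge0.
  have [k /andP[k1 k2]] := archC ms0.
  have [r er] : exists r, r = m%:R * s - k%:R by eexists.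
  have r0 : 0 <= r by rewrite er subr_ge0.
  have r1 : 0 <= 1 - r by rewrite subr_ge0 er lerBlDr addrC natr1 ltW.
  have -> : D s *+ m = D r.
    rewrite -Dmn -(subrK k%:R (m%:R * s)) -er DD.
    by rewrite -[k%:R]mulr1 Dmn D1 mul0rn addr0.
  have Fu1 : F u = F (scal S (1 - r) * u) + F (scal S r * u).
    by rewrite -FD // -mulrDl -scalD subrK scal1 mul1r.
  have Fu2 : F u = scal T (1 - r) * F u + scal T r * F u.
    by rewrite -mulrDl -scalD subrK scal1 mul1r.
  split.
    have -> : F u - D r = F (scal S (1 - r) * u) + scal T r * F u.
      by rewrite {1}Fu1 /D opprB addrACA addrN addr0.
    by apply: (posD cone); [exact: pos_g | exact: pos_G].
  have -> : F u + D r = F (scal S r * u) + scal T (1 - r) * F u.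
    by rewrite {1}Fu2 /D addrACA addrN addr0 addrC.
  by apply: (posD cone); [exact: pos_g | exact: pos_G].
move=> tr; apply/eqP; rewrite -subr_eq0 -/(D t); apply/eqP.
case/real_ge0P: tr => [/main //|/ltW t0].
have := DD t (- t); rewrite (main (- t)) ?oppr_ge0 // addr0 subrr => <-.
by rewrite /D !scal0 !mul0r additive0 subrr.
Qed.

Lemma real_linear t x : t \is Num.real -> X x -> F (scal S t * x) = scal T t * F x.
Proof.
move=> tr Xx; rewrite -[x in LHS]uX // mulrA FM //; rewrite real_unit_linear // -mulrA -FM ?uX //.
by case: pu.
Qed.

Definition complexify x := F (sre x) + scal T 'i * F (sim x).

Let FB x y : X x -> X y -> F (x - y) = F x - F y.
Proof.
move=> Xx Xy; apply: (addIr (F y)); rewrite subrK -FD ?subrK //; exact: subB.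
Qed.

Lemma complexifyE x y : star x = x -> star y = y -> complexify (x + scal S 'i * y) = F x + scal T 'i * F y.
Proof. by move=> sx sy; rewrite /complexify sre_unique ?sim_unique. Qed.

Lemma complexify_selfadjoint x : X x -> star x = x -> complexify x = F x.
Proof.
move=> Xx sx; have := complexifyE sx (star0 S); rewrite mulr0 addr0 => ->.
by rewrite additive0 mulr0 addr0.
Qed.

Section Properties.
Variables (x : S) (Xx : X x).
Let a := sre x.
Let b := sim x.
Let Xa : X a. Proof. exact: sre_subalg. Qed.
Let Xb : X b. Proof. exact: sim_subalg. Qed.
Let sa : star a = a. Proof. exact: star_sre. Qed.
Let sb : star b = b. Proof. exact: star_sim. Qed.
Let ex : x = a + scal S 'i * b. Proof. by rewrite sre_sim. Qed.
Let FSa : star (F a) = F a. Proof. by rewrite -FS // sa. Qed.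
Let FSb : star (F b) = F b. Proof. by rewrite -FS // sb. Qed.

Lemma complexifyD y : X y -> complexify (x + y) = complexify x + complexify y.
Proof.
move=> Xy; have [Xc Xd] : X (sre y) /\ X (sim y) by split; [exact: sre_subalg | exact: sim_subalg].
rewrite {1}ex -{1}(sre_sim y) [a + _ + _]addrACA -[scal S 'i * b + _]mulrDr complexifyE ?starD ?sa ?sb ?star_sre ?star_sim //.
by rewrite !FD // mulrDr addrACA.
Qed.

Lemma complexifyZ k : complexify (scal S k * x) = scal T k * complexify x.
Proof.
have Xr r y : X y -> X (scal S r * y) by apply: (subZ sX).
have Rr := Creal_Re k; have Ri := Creal_Im k.
have e (U : staralg C) (c d : U) : scal U k * (c + scal U 'i * d) =
    (scal U ('Re k) * c - scal U ('Im k) * d) +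
    scal U 'i * (scal U ('Re k) * d + scal U ('Im k) * c).
  have h : 'i * 'Im k * 'i = - 'Im k by rewrite mulrAC -expr2 sqrCi mulN1r.
  rewrite {1}[k]Crect scalD mulrDl !mulrDr !mulrA -!scalM h scalN mulNr ['Re k * 'i]mulrC.
  by rewrite [X in _ + X = _]addrC addrACA.
have sr r y : r \is Num.real -> star y = y -> star (scal S r * y) = scal S r * y.
  by move=> /CrealP rr sy; rewrite starM star_scal rr sy scalC.
rewrite {1}ex e complexifyE; last by rewrite starD (sr _ a) ?(sr _ b).
  rewrite FB ?FD ?(real_linear _ Xa) ?(real_linear _ Xb) //; try exact: Xr.
  by rewrite /complexify -/a -/b e.
by rewrite starB (sr _ a) ?(sr _ b).
Qed.

Lemma complexifyS : complexify (star x) = star (complexify x).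
Proof.
have -> : star x = a + scal S 'i * (- b).
  by rewrite {1}ex starD starM sa sb star_scal conjCi scalN mulrN mulrN -scalC.
rewrite complexifyE ?starN ?sb //.
have -> : F (- b) = - F b by rewrite -sub0r FB ?additive0 ?sub0r //; exact: sub0.
by rewrite /complexify starD starM FSa FSb star_scal conjCi scalN !mulrN -scalC.
Qed.

(** The real part [a * a - b * b] and the imaginary part [a * b + b * a] of the square are
    self-adjoint and expressed by products, on which [F] is multiplicative. *)
Lemma complexify_sq : complexify (x * x) = complexify x * complexify x.
Proof.
have e (U : staralg C) (c d : U) : (c + scal U 'i * d) * (c + scal U 'i * d) =
    (c * c - d * d) + scal U 'i * (c * d + d * c).
  rewrite mulrDl !mulrDr scalMM -['i * 'i]expr2 sqrCi scalN scal1 mulN1r -scalMl -mulrA.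
  by rewrite [X in _ + X = _]addrC addrACA -mulrDr.
have Xab c d : X c -> X d -> X (c * d) by apply: (subM sX).
have s1 : star (a * a - b * b) = a * a - b * b by rewrite starB (starM a) (starM b) sa sb.
have s2 : star (a * b + b * a) = a * b + b * a.
  by rewrite starD (starM a) (starM b) sa sb addrC.
rewrite {1 2}ex e complexifyE //.
rewrite FB ?FD ?(FM Xa Xa) ?(FM Xb Xb) ?(FM Xa Xb) ?(FM Xb Xa) //; try exact: Xab.
by rewrite /complexify -/a -/b e.
Qed.

Lemma complexify_inj : (forall y, X y -> F y = 0 -> y = 0) -> complexify x = 0 -> x = 0.
Proof.
move=> inj h.
have ha : F a = 0.
  by rewrite -(sre_unique FSa FSb) -[X in sre X]/(complexify x) h /sre star0 addr0 mulr0.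
have hb : F b = 0.
  by rewrite -(sim_unique FSa FSb) -[X in sim X]/(complexify x) h /sim star0 subr0 mulr0.
by rewrite [LHS]ex (inj a Xa ha) (inj b Xb hb) mulr0 addr0.
Qed.
End Properties.
End ComplexLinear.

(** * Self-adjoint elements with finite spectrum *)

Section Spectral.
Variables (C : numClosedFieldType) (L : staralg C) (X : L -> Prop).
Hypotheses (sX : subalg X) (pd : posdef L).
Implicit Types (h : L) (s : seq C).

Definition annihilator h s := \prod_(l <- s) (h - scal L l).

(** The separate factor [h] carries the root 0 and keeps the polynomial inside [X], which may lack a
    unit. The list [s] may have repetitions. *)
Definition annihilated := forall h, X h -> star h = h ->
  exists2 s, all (fun l => (l \is Num.real) && (l != 0)) s & h * annihilator h s = 0.

Lemma annihilator_cons h l s : annihilator h (l :: s) = (h - scal L l) * annihilator h s.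
Proof. by rewrite /annihilator big_cons. Qed.

Lemma annihilator_mul h s : X h -> star h = h -> all (fun l => l \is Num.real) s ->
  X (h * annihilator h s) /\ star (h * annihilator h s) = h * annihilator h s.
Proof.
move=> Xh sh sr.
have [e1 e2] : star (annihilator h s) = annihilator h s /\ annihilator h s * h = h * annihilator h s.
  elim: s sr => [_|l s IH /= /andP[lr /IH[e1 e2]]].
    by rewrite /annihilator big_nil star1 mul1r mulr1.
  have c : annihilator h s * (h - scal L l) = (h - scal L l) * annihilator h s.
    by rewrite mulrBr mulrBl e2 scalC.
  rewrite annihilator_cons; split.
    by rewrite starM e1 starB sh star_scal; move/CrealP: lr => ->.
  by rewrite -mulrA e2 !mulrA; congr (_ * _); rewrite mulrBl mulrBr scalC.
split; last by rewrite starM e1 sh.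
elim: (s) => [|l t IH]; first by rewrite /annihilator big_nil mulr1.
have -> : h * annihilator h (l :: t) = h * (h * annihilator h t) - scal L l * (h * annihilator h t).
  by rewrite annihilator_cons mulrA mulrBr mulrBl -scalC -!mulrA.
by apply: subB => //; [exact: (subM sX) | exact: (subZ sX)].
Qed.

(** Each factor is [- l] times [1 - l^-1 h], so the product is a nonzero constant times [1 - h g],
    with [g] a polynomial in [h]. Its constant term [m] is kept apart because scalars need not
    belong to [X]. *)
Lemma annihilator_expand h s : X h -> all (fun l => l != 0) s ->
  exists (c m : C) (r : L), [/\ c != 0, X r, r * h = h * r &
    annihilator h s = scal L c * (1 - h * (scal L m + r))].
Proof.
move=> Xh; elim: s => [_|l s IH /= /andP[l0 /IH[c [m [r [c0 Xr rh e]]]]]].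
  exists 1, 0, 0; split; rewrite ?oner_neq0 ?mulr0 ?mul0r //; first exact: sub0.
  by rewrite /annihilator big_nil scal0 addr0 mulr0 subr0 scal1 mulr1.
pose t := scal L l^-1; pose g := scal L m + r.
have gh : g * h = h * g by rewrite mulrDl mulrDr scalC rh.
(* Read off from [(1 - t h) (1 - h g) = 1 - h (g + t - t h g)]. *)
exists (- l * c), (m + l^-1), (r - t * (h * g)); split.
- by rewrite mulf_neq0 ?oppr_eq0.
- apply: subB => //; apply: (subZ sX); rewrite mulrDr -scalC.
  by apply: (subD sX); [exact: (subZ sX) | exact: (subM sX)].
- by rewrite mulrBl mulrBr rh -!mulrA gh scalMl.
rewrite annihilator_cons e -/g.
have -> : h - scal L l = scal L (- l) * (1 - t * h).
  by rewrite scalN mulNr mulrBr mulr1 mulrA -scalM mulfV // scal1 mul1r opprB.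
rewrite scalMM; congr (_ * _).
rewrite scalD -addrA [scal L _ + (r - _)]addrCA addrA -/g -/t.
have -> : h * (g + (t - t * (h * g))) = h * g + (t * h - t * h * (h * g)).
  by rewrite mulrDr mulrBr -[h * t]scalC -[t * h * _]mulrA [t * (h * (h * g))]scalMl.
by rewrite mulrBl mul1r [t * h * (1 - _)]mulrBr mulr1 [in RHS]opprD addrA.
Qed.

(** After division by [c] the relation reads [h * (h * r) = h] with [r] commuting with [h]. The
    inverse is [h * r * r]; its factor [h] keeps it in [X]. *)
Lemma group_inverse h s : X h -> all (fun l => l != 0) s -> h * annihilator h s = 0 ->
  exists2 k, X k & [/\ h * k = k * h, h * k * h = h & k * h * k = k].
Proof.
move=> Xh s0 hs; have [c [m [r0 [c0 Xr rh e]]]] := annihilator_expand Xh s0.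
have [r er] : exists r, r = scal L m + r0 by eexists.
have hr : r * h = h * r by rewrite er mulrDl mulrDr scalC rh.
have hhr : h * (h * r) = h.
  move: hs; rewrite e -er -scalMl => /(congr1 (fun x => scal L c^-1 * x)).
  by rewrite scalVK // mulr0 mulrBr mulr1 => /eqP; rewrite subr_eq0 => /eqP.
have Xz : X (h * r).
  by rewrite er mulrDr -scalC; apply: (subD sX); [exact: (subZ sX) | exact: (subM sX)].
have hk : h * (h * r * r) = h * r by rewrite mulrA hhr.
have kh : h * r * r * h = h * r by rewrite -mulrA hr mulrA -[h * r * h]mulrA hr hhr.
exists (h * r * r).
  by rewrite {2}er mulrDr -scalC; apply: (subD sX); [exact: (subZ sX) | exact: (subM sX)].
split; first by rewrite hk kh.
  by rewrite hk -mulrA hr hhr.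
by rewrite kh !mulrA -[h * r * h]mulrA hr hhr.
Qed.

Lemma annihilated_regular : annihilated -> regular X.
Proof.
move=> aX; apply: regular_of_selfadjoint => // h Xh sh; have [s hs e] := aX h Xh sh.
by apply: (group_inverse Xh _ e); apply: sub_all hs => l /andP[].
Qed.

(* The span of the projections in [h X] is encoded impredicatively. *)
Definition spanned := forall h, X h -> star h = h -> forall Z : L -> Prop,
  Z 0 -> (forall x y, Z x -> Z y -> Z (x + y)) -> (forall k x, Z x -> Z (scal L k * x)) ->
  (forall p z, proj X p -> p = h * z -> Z p) -> Z h.

Lemma support_projection h : regular X -> X h -> star h = h ->
  exists q b, [/\ proj X q, q = h * b, q = star b * h, q * h = h & h * q = h].
Proof.
move=> rX Xh sh; have [b Xb [h1 h2 h3 h4]] := rX h Xh; exists (h * b), b.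
have pq : proj X (h * b) by split => //; [exact: (subM sX) | rewrite mulrA h1].
split=> //; first by rewrite -h3 starM sh.
by have := congr1 (@star C L) h1; rewrite starM h3 sh.
Qed.

(** One spectral value is split off at a time. With [q] the support of [h] and [q'] that of
    [h * (h - l)], [h] acts on [q - q'] as the scalar [l], and [h * q'] is annihilated by the
    remaining factors. *)
Lemma annihilated_spanned : annihilated -> spanned.
Proof.
move=> aX; have rX := annihilated_regular aX.
move=> h Xh sh Z Z0 ZD ZS Zp; have [s hs e] := aX h Xh sh.
elim: s h Xh sh Zp hs e => [|l s IH] h Xh sh Zp /=.
  by move=> _; rewrite /annihilator big_nil mulr1 => ->.
move=> /andP[/andP[lr l0] hs] e.
have sl : star (scal L l) = scal L l by rewrite star_scal; move/CrealP: lr => ->.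
have [N eN] : exists N, N = h * (h - scal L l) by eexists.
have XN : X N.
  by rewrite eN mulrBr -scalC; apply: subB => //; [exact: (subM sX) | exact: (subZ sX)].
have hlC : (h - scal L l) * h = h * (h - scal L l) by rewrite mulrBl mulrBr scalC.
have sN : star N = N by rewrite eN starM starB sh sl hlC.
have [q [b [pq q1 q2 qh hq]]] := support_projection rX Xh sh.
have [q' [b' [pq' q1' q2' qN Nq]]] := support_projection rX XN sN.
have hN : h * N = N * h by rewrite eN -!mulrA hlC.
have q'h : q' * h = h * q'.
  have e0 : h * q' = N * (h * b') by rewrite [in LHS]q1' mulrA hN mulrA.
  have e1 : h * q' = q' * (h * q') by rewrite e0 [RHS]mulrA qN.
  have [_ _ sq'] := pq'.
  have := congr1 (@star C L) e1; rewrite !starM sq' sh => ->.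
  by rewrite -mulrA -e1.
have qq' : q * q' = q' by rewrite q1' eN !mulrA qh.
have pp := projB sX pq' pq qq'.
have [_ qq _] := pq; have [_ q'q' _] := pq'.
have hp : h * (q - q') = scal L l * (q - q').
  have Np : h * ((h - scal L l) * (q - q')) = 0.
    by rewrite mulrA -eN mulrBr Nq eN -hlC -mulrA hq subrr.
  have : q * ((h - scal L l) * (q - q')) = 0 by rewrite {1}q2 -mulrA Np mulr0.
  have qp : q * (q - q') = q - q' by rewrite mulrBr qq qq'.
  move: qp; move: (q - q') => p qp.
  by rewrite mulrBl mulrBr mulrA qh -scalMl qp => /eqP; rewrite subr_eq0 => /eqP.
have eh : h = scal L l * (q - q') + h * q' by rewrite -hp -mulrDr subrK hq.
have absorb t : q' * annihilator (h * q') t = q' * annihilator h t.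
  elim: t => [|x t IHt]; first by rewrite /annihilator !big_nil.
  have c x' : q' * (h - scal L x') = (h - scal L x') * q' by rewrite mulrBl mulrBr q'h scalC.
  rewrite !annihilator_cons !mulrA c -[RHS]mulrA -IHt mulrA; congr (_ * _).
  by rewrite mulrBr mulrBl -!q'h !mulrA q'q' scalC.
rewrite eh; apply: ZD.
  (* The witness comes from [q = h * b] and [q' = h * (h - l) * b']. *)
  apply: ZS; apply: (Zp _ (b - (h - scal L l) * b')) => //.
  by rewrite mulrBr mulrA -eN q1 q1'.
apply: IH => //.
- by apply: (subM sX) => //; case: pq'.
- by rewrite starM sh; have [_ _ ->] := pq'.
- by move=> p z pz ez; apply: (Zp _ (q' * z)) => //; rewrite mulrA.
- rewrite -mulrA absorb mulrA -q'h q2' -!mulrA [N * _]mulrA -hN -mulrA eN -mulrA.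
  by rewrite -annihilator_cons e !mulr0.
Qed.
End Spectral.

(** * Extension of orthoisomorphisms *)

Definition alg (C : numClosedFieldType) (L : staralg C) : salg C :=
  @SAlg C L 0 +%R (fun k x => scal L k * x) *%R (@star C L).

(** Polarizing squares, [F] preserves [x y + y x]. For projections [p q = 0] is equivalent to
    [p q + q p = 0]: multiplying the latter by [p] on either side gives [p q = - p q p = q p], hence
    [2 p q = 0]. *)
Lemma jordan_orthoiso (C : numClosedFieldType) (S T : staralg C) (X : S -> Prop) (Y : T -> Prop)
    (F : S -> T) : subalg X ->
  jordan_star_iso (S1 := alg S) (S2 := alg T) X Y F -> orthoiso (S1 := alg S) (S2 := alg T) X Y F.
Proof.
move=> sX [FY [Finj [Fsurj [/= FD [FZ [FS Fsq]]]]]].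
have F0 : F 0 = 0 by apply: (addrI (F 0)); rewrite -FD ?addr0 //; exact: sub0.
have Fjordan x y : X x -> X y -> F (x * y + y * x) = F x * F y + F y * F x.
  move=> Xx Xy; have [Xxy Xyx] : X (x * y) /\ X (y * x) by split; exact: (subM sX).
  have Xxx := subM sX Xx Xx; have Xyy := subM sX Xy Xy.
  have := Fsq _ (subD sX Xx Xy); rewrite FD // !mulrDl !mulrDr -!Fsq //.
  have -> : x * x + x * y + (y * x + y * y) = x * x + (x * y + y * x) + y * y by rewrite !addrA.
  rewrite !FD //; try by do ?[apply: (subD sX)].
  by rewrite !addrA => /addIr; rewrite -!addrA => /addrI.
have orth (U : staralg C) (p q : U) : p * p = p -> p * q + q * p = 0 -> p * q = 0.
  move=> pp h.
  have h1 : p * q + p * q * p = 0.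
    by have := congr1 (fun x => p * x) h; rewrite mulr0 mulrDr !mulrA pp.
  have h2 : q * p + p * q * p = 0.
    by have := congr1 (fun x => x * p) h; rewrite mul0r mulrDl -[q * p * p]mulrA pp addrC.
  have e : p * q = q * p by apply: (addIr (p * q * p)); rewrite h1 h2.
  by rewrite -[LHS]scal_half {2}e h mulr0.
have Fproj p : is_proj (S := alg S) X p -> is_proj (S := alg T) Y (F p).
  by move=> [/= Xp pp sp]; split; rewrite /= -?Fsq -?FS ?pp ?sp //; exact: FY.
split=> [//|q [Yq /= qq sq]|p q pp pq].
  have [p Xp ep] := Fsurj q Yq; rewrite /= in ep.
  have pp : is_proj (S := alg S) X p.
    split=> //=; apply: Finj => //; rewrite ?Fsq ?FS ?ep //.
      exact: (subM sX).
    exact: (subS sX).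
  exists p; split=> // r [[Xr _ _] er]; apply: Finj => //.
  by rewrite er.
have [[Xp /= pp1 sp] [Xq /= qq1 sq]] := (pp, pq).
have [[Yp /= pp2 sp2] [Yq /= qq2 sq2]] := (Fproj _ pp, Fproj _ pq).
have comm (U : staralg C) (x y : U) : star x = x -> star y = y -> x * y = 0 -> x * y + y * x = 0.
  by move=> sx sy xy; rewrite xy add0r -sx -sy -starM xy star0.
split=> /= h.
  by apply: orth => //; rewrite -Fjordan // (comm S) // F0.
apply: orth => //; apply: Finj; rewrite ?F0 ?Fjordan ?(comm T) //.
  by apply: (subD sX); exact: (subM sX).
exact: sub0.
Qed.

Section Dye.
Variables (C : numClosedFieldType) (L T : staralg C) (n : nat).
Variables (A : L -> Prop) (B : T -> Prop) (psi : mat_staralg L n -> T) (pos : T -> Prop).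
Hypotheses (archC : archimedean C) (cone : positive_cone pos) (n3 : (3 <= n)%N).
Hypotheses (pdL : posdef L) (pdT : posdef T) (sA : subalg A) (sB : subalg B).
Hypotheses (aA : annihilated A) (aB : annihilated B).
Local Notation M := (@mat_sub C L n A).
Local Notation mu := (@mu C L n).
Hypothesis psi_iso : orthoiso (S1 := alg (mat_staralg L n)) (S2 := alg T) M B psi.

Let rA := annihilated_regular sA pdL aA.
Let rB := annihilated_regular sB pdT aB.
Let psiP p : proj M p -> proj B (psi p).
Proof. by case: psi_iso => + _ _; apply. Qed.
Let psi_surj q : proj B q -> exists2 p, proj M p & psi p = q.
Proof. by case: psi_iso => _ + _ => /[apply] -[p [[pp e] _]]; exists p. Qed.
Let psiO p q : proj M p -> proj M q -> (p * q = 0 <-> psi p * psi q = 0).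
Proof. by case: psi_iso => _ _; apply. Qed.

Definition corner_mat e : mat_staralg L n -> Prop := mat_sub (corner A e).

Record linear_on (X : mat_staralg L n -> Prop) (F : mat_staralg L n -> T) : Prop := {
  linD : forall x y, X x -> X y -> F (x + y) = F x + F y;
  linZ : forall k x, X x -> F (scal _ k * x) = scal T k * F x }.

Definition extends_on e (F : mat_staralg L n -> T) :=
  [/\ linear_on (corner_mat e) F, (forall x, corner_mat e x -> B (F x)),
      (forall x, corner_mat e x -> F (star x) = star (F x)),
      (forall x, corner_mat e x -> F (x * x) = F x * F x) &
      (forall x, corner_mat e x -> F x = 0 -> x = 0) /\
      (forall p, proj M p -> corner_mat e p -> F p = psi p)].

Lemma corner_subalg e : proj A e -> subalg (corner A e).
Proof.
move=> pe; split; [exact: corner0 | exact: cornerD | exact: cornerM | exact: cornerS |].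
move=> k x [Ax ex xe]; split; first exact: (subZ sA).
  by rewrite -scalMl ex.
by rewrite -mulrA xe.
Qed.

Lemma extends_exists e : proj A e -> exists F, extends_on e F.
Proof.
move=> pe; have [F [FB FD FM FS [Finj Fpsi]]] := coordinates pdL pdT sA sB rA rB psiP psi_surj psiO pe n3.
have sX : subalg (corner_mat e) := mat_subalg n (corner_subalg pe).
have pu : proj (corner_mat e) ((e%:M : 'M[L]_n) : mat_staralg L n).
  have [_ uu su] : proj M (e%:M : 'M[L]_n) by exact: proj_scalar_mx.
  split=> //.
  by move=> i j; rewrite mxE; case: eqP => _; [exact: corner_e | exact: corner0].
have uX x : corner_mat e x -> (e%:M : 'M[L]_n) * x = x by exact: (@unit_mul C L n A e).
exists (complexify F); split.
- split=> [x y hx hy | k x hx].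
    exact: (complexifyD sX FD).
  exact: (complexifyZ archC cone sX pu uX FD FM FS hx).
- move=> x hx; apply: (subD sB); first by exact/FB/(sre_subalg sX hx).
  by apply: (subZ sB); exact/FB/(sim_subalg sX hx).
- by move=> x hx; apply: (complexifyS sX FD FS).
- by move=> x hx; apply: (complexify_sq sX FD FM).
- split=> [x hx|p pp hp].
    exact: (complexify_inj sX FS).
  by rewrite (complexify_selfadjoint sX FD) ?Fpsi //; case: pp.
Qed.

(** Projections span M_n(e A e). Since they span [A], only [mu p i j] with [p] a projection must be
    reached. For [|w| = 1] half the sum of [mu p i i], [mu p j j], [w mu p i j] and its adjoint is a
    projection. This serves both the compatibility of the local maps and the uniqueness. *)
Lemma linear_agree e F G : proj A e -> linear_on (corner_mat e) F -> linear_on (corner_mat e) G ->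
  (forall p, proj M p -> corner_mat e p -> F p = G p) -> forall x, corner_mat e x -> F x = G x.
Proof.
move=> pe [FD FZ] [GD GZ] agree.
have sX : subalg (corner_mat e) := mat_subalg n (corner_subalg pe).
have sc := corner_subalg pe.
pose Z x := corner_mat e x /\ F x = G x.
have ZD x y : Z x -> Z y -> Z (x + y).
  by move=> [hx ex] [hy ey]; split; [exact: (subD sX) | rewrite FD // GD // ex ey].
have ZZ k x : Z x -> Z (scal _ k * x).
  by move=> [hx ex]; split; [exact: (subZ sX) | rewrite FZ // GZ // ex].
have ZB x y : Z x -> Z y -> Z (x - y).
  by move=> hx hy; apply: ZD => //; rewrite -mulN1r -(scal1 (mat_staralg L n)) -scalN; exact: ZZ.
have Zh x : Z (x + x) -> Z x by move/(ZZ 2^-1); rewrite scal_half.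
have Z0 : Z 0.
  split; first exact: sub0.
  have := FZ 0 0 (sub0 sX); have := GZ 0 0 (sub0 sX).
  by rewrite !scal0 !mul0r => -> ->.
have Zdiag p i : proj A p -> corner A e p -> Z (mu p i i).
  move=> pp hp; have hm : corner_mat e (mu p i i) by exact: corner_mu.
  by split=> //; apply: agree => //; exact: proj_mu.
have half2 : 2^-1 + 2^-1 = 1 :> C by have := splitr (1 : C); rewrite !mul1r.
have half_proj w p i j : i != j -> w * w^* = 1 -> proj A p -> corner A e p ->
    Z (scal _ w * mu p i j + scal _ w^* * mu p j i).
  move=> ij w1 pp hp; have [Ap ppp sp] := pp.
  have ji : j != i by rewrite eq_sym.
  set c := scal _ w * _; set d := scal _ w^* * _.
  pose a := mu p i i; pose b := mu p j j.
  have [Za Zb] : Z a /\ Z b by split; exact: Zdiag.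
  have [[ha _] [hb _]] := (Za, Zb).
  have hc : corner_mat e c by apply: (subZ sX); exact: corner_mu.
  have hd : corner_mat e d by apply: (subZ sX); exact: corner_mu.
  have [sa' sb'] : star a = a /\ star b = b by rewrite !mu_star sp.
  have scd : star c = d by rewrite starM mu_star sp star_scal -scalC.
  have aa : a * a = a by rewrite muM ppp.
  have bb : b * b = b by rewrite muM ppp.
  have ab : a * b = 0 by rewrite muM0.
  have ba : b * a = 0 by rewrite muM0.
  have ac : a * c = c by rewrite -scalMl muM ppp.
  have ad : a * d = 0 by rewrite -scalMl muM0 ?mulr0.
  have bd : b * d = d by rewrite -scalMl muM ppp.
  have bc : b * c = 0 by rewrite -scalMl muM0 ?mulr0.
  have ca : c * a = 0 by rewrite -mulrA muM0 ?mulr0.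
  have cb : c * b = c by rewrite -mulrA muM ppp.
  have cc : c * c = 0 by rewrite scalMM muM0 ?mulr0.
  have cd : c * d = a by rewrite scalMM muM ppp w1 scal1 mul1r.
  have da : d * a = d by rewrite -mulrA muM ppp.
  have db : d * b = 0 by rewrite -mulrA muM0 ?mulr0.
  have dc : d * c = b by rewrite scalMM muM ppp mulrC w1 scal1 mul1r.
  have dd : d * d = 0 by rewrite scalMM muM0 ?mulr0.
  pose V := (a + b) + (c + d).
  have hV : corner_mat e V by do !apply: (subD sX).
  have VV : V * V = V + V.
    rewrite {1 2}/V !mulrDl !mulrDr aa ab ac ad ba bb bc bd ca cb cc cd da db dc dd.
    rewrite !addr0 !add0r [c + a]addrC [d + b]addrC.
    by rewrite [a + c + (b + d)]addrACA.
  have pv : proj M (scal _ 2^-1 * V).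
    split; first by apply: (subZ (mat_subalg n sA)); exact: corner_sub hV.
      by rewrite scalMM VV scalM -mulrA; congr (_ * _); exact: scal_half.
    rewrite starM star_scal conj_half -scalC; congr (_ * _).
    have std : star d = c by rewrite -scd starK.
    by rewrite /V (starD (a + b)) (starD a) (starD c) sa' sb' scd std [d + c]addrC.
  have Zv : Z (scal _ 2^-1 * V).
    have h : corner_mat e (scal _ 2^-1 * V) by exact: (subZ sX).
    by split=> //; apply: agree.
  have -> : c + d = scal _ 2^-1 * V + scal _ 2^-1 * V - (a + b).
    by rewrite -mulrDl -scalD half2 scal1 mul1r /V addrAC subrr add0r.
  by apply: ZB; [exact: ZD | exact: ZD].
have Zoff p i j : proj A p -> corner A e p -> Z (mu p i j).
  move=> pp hp; case: (eqVneq i j) => [<-|ij]; first exact: Zdiag.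
  have h1 := half_proj 1 p i j ij; rewrite rmorph1 mulr1 scal1 !mul1r in h1.
  have h2 := half_proj 'i p i j ij; rewrite conjCi mulrN -expr2 sqrCi opprK in h2.
  (* The matrix for [w = 1] plus [- 'i] times the one for [w = 'i] is twice [mu p i j]. *)
  have := ZD _ _ (h1 erefl pp hp) (ZZ (- 'i) _ (h2 erefl pp hp)).
  rewrite mulrDr !mulrA -!scalM mulrNN mulNr -expr2 sqrCi opprK scal1 mul1r scalN scal1 mulN1r.
  by rewrite addrACA subrr addr0; exact: Zh.
have Zmu a i j : corner A e a -> Z (mu a i j).
  have muZ k b : mu (scal L k * b) i j = scal _ k * mu b i j.
    by apply/matrixP => p q; rewrite mscalE !muE; case: ifP; rewrite ?mulr0.
  have main h : corner A e h -> star h = h -> Z (mu h i j).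
    move=> [Ah eh he] sh; apply: (annihilated_spanned sA pdL aA Ah sh (Z := fun b => Z (mu b i j))).
    - by rewrite mu0.
    - by move=> x y; rewrite muD; exact: ZD.
    - by move=> k x; rewrite muZ; exact: ZZ.
    - move=> p z pp pz; have ep : e * p = p by rewrite pz mulrA eh.
      by apply: Zoff => //; split=> //; [case: pp | exact: (proj_leC pp pe ep)].
  move=> ha; rewrite -(sre_sim a) muD muZ; apply: ZD.
    by apply: main; [exact: (sre_subalg sc) | exact: star_sre].
  by apply: ZZ; apply: main; [exact: (sim_subalg sc) | exact: star_sim].
move=> x hx; suff [] : Z x by [].
rewrite (mat_sum_mu x); do 2![apply: big_ind => // ? _]; exact: Zmu.
Qed.

Lemma corner_le e u x : u * e = e -> e * u = e -> corner A e x -> corner A u x.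
Proof.
move=> ue eu [Ax ex xe]; split=> //; first by rewrite -ex mulrA ue.
by rewrite -xe -mulrA eu.
Qed.

Lemma common_unit x y : M x -> M y -> exists e, [/\ proj A e, corner_mat e x & corner_mat e y].
Proof.
move=> hx hy.
have [|e pe he] := mat_units pdL sA rA (x := fun t : 'I_2 => if t == ord0 then x else y).
  by move=> t; case: ifP.
exists e; split=> // i j.
  by have [] := he ord0 i j; split.
by have [] := he ord_max i j; split.
Qed.

Definition local_ext e := epsilon (inhabits (fun=> 0)) (extends_on e).
Definition some_unit x := epsilon (inhabits 0) (fun e => proj A e /\ corner_mat e x).
Definition global_ext x := local_ext (some_unit x) x.

Lemma local_extP e : proj A e -> extends_on e (local_ext e).
Proof. by move=> pe; apply: epsilon_spec; exact: extends_exists. Qed.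

Lemma linear_on_sub (X Y : mat_staralg L n -> Prop) F :
  (forall x, X x -> Y x) -> linear_on Y F -> linear_on X F.
Proof. by move=> XY [FD FZ]; split=> *; [apply: FD | apply: FZ]; exact: XY. Qed.

Lemma local_ext_le e u x : proj A e -> proj A u -> u * e = e -> e * u = e ->
  corner_mat e x -> local_ext e x = local_ext u x.
Proof.
move=> pe pu ue eu; have [lF _ _ _ [_ Fp]] := local_extP pe.
have [lG _ _ _ [_ Gp]] := local_extP pu.
have sub y : corner_mat e y -> corner_mat u y by move=> hy i j; exact: (corner_le ue eu).
apply: (linear_agree pe lF (linear_on_sub sub lG)) => p pp hp.
by rewrite Fp ?Gp //; exact: sub.
Qed.

(** Corners are directed: the chosen unit of [x] and [e] lie below a common projection [u], and both
    local maps agree with that of [u] at [x]. *)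
Lemma global_extE e x : proj A e -> corner_mat e x -> global_ext x = local_ext e x.
Proof.
move=> pe hx; have [pv hv] : proj A (some_unit x) /\ corner_mat (some_unit x) x.
  have h : exists e, proj A e /\ corner_mat e x by exists e.
  exact: (epsilon_spec (inhabits 0) _ h).
have [Av _ _] := pv; have [Ae _ _] := pe.
have [u pu [h1 h2 h3 h4]] := regular_local_units sA pdL rA Av Ae.
by rewrite /global_ext (local_ext_le pv pu) // (local_ext_le pe pu).
Qed.

Lemma corner_mat_sub e x : corner_mat e x -> M x.
Proof. by move=> hx i j; case: (hx i j). Qed.

Let sM : subalg M := mat_subalg n sA.

Lemma global_ext_lin : linear_on M global_ext.
Proof.
split=> [x y hx hy|k x hx].
  have [e [pe ex ey]] := common_unit hx hy; have [[FD _] _ _ _ _] := local_extP pe.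
  rewrite !(global_extE pe) ?FD //; exact: (subD (mat_subalg n (corner_subalg pe))).
have [e [pe ex _]] := common_unit hx hx; have [[_ FZ] _ _ _ _] := local_extP pe.
rewrite !(global_extE pe) ?FZ //; exact: (subZ (mat_subalg n (corner_subalg pe))).
Qed.

Lemma global_ext_psi p : proj M p -> global_ext p = psi p.
Proof.
move=> pp; have [Mp _ _] := pp; have [e [pe ex _]] := common_unit Mp Mp.
have [_ _ _ _ [_ Fp]] := local_extP pe.
by rewrite (global_extE pe) ?Fp.
Qed.

(** [B] is spanned by its projections, each of which is a value of [psi]. *)
Lemma global_ext_surj y : B y -> exists2 x, M x & global_ext x = y.
Proof.
have [GD GZ] := global_ext_lin.
have main h : B h -> star h = h -> exists2 x, M x & global_ext x = h.
  move=> Bh sh; apply: (annihilated_spanned sB pdT aB Bh sh (Z := fun h => exists2 x, M x & global_ext x = h)).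
  - exists 0; first exact: (sub0 sM).
    by have := GZ 0 0 (sub0 sM); rewrite !scal0 !mul0r.
  - move=> _ _ [x hx <-] [x' hx' <-]; exists (x + x'); last exact: GD.
    exact: (subD sM).
  - move=> k _ [x hx <-]; exists (scal _ k * x); last exact: GZ.
    exact: (subZ sM).
  - move=> q _ pq _; have [p pp <-] := psi_surj pq.
    by exists p; [case: pp | exact: global_ext_psi].
move=> By; rewrite -(sre_sim y).
have [x hx <-] := main _ (sre_subalg sB By) (star_sre y).
have [x' hx' <-] := main _ (sim_subalg sB By) (star_sim y).
have hx'' : M (scal _ 'i * x') by exact: (subZ sM).
by exists (x + scal _ 'i * x'); [exact: (subD sM) | rewrite GD // GZ].
Qed.

Theorem orthoiso_extension : exists phi : mat_staralg L n -> T,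
  [/\ jordan_star_iso (S1 := alg (mat_staralg L n)) (S2 := alg T) M B phi,
      (forall p, proj M p -> phi p = psi p) &
      (forall phi' : mat_staralg L n -> T,
         jordan_star_iso (S1 := alg (mat_staralg L n)) (S2 := alg T) M B phi' ->
         (forall p, proj M p -> phi' p = psi p) -> forall x, M x -> phi' x = phi x)].
Proof.
have [GD GZ] := global_ext_lin.
exists global_ext; split; [|exact: global_ext_psi|].
  split=> [x hx|].
    have [e [pe ex _]] := common_unit hx hx; have [_ FB _ _ _] := local_extP pe.
    by rewrite (global_extE pe) //; exact: FB.
  split=> [x y hx hy exy|].
    have [e [pe ex ey]] := common_unit hx hy; have [[FD FZ] _ _ _ [Finj _]] := local_extP pe.
    have se := mat_subalg n (corner_subalg pe).
    apply/eqP; rewrite -subr_eq0; apply/eqP; apply: Finj; first exact: (subB se).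
    rewrite !(global_extE pe) // in exy.
    have hN : corner_mat e (- y) by exact: (subN se).
    rewrite FD //; apply: (addIr (local_ext e y)); rewrite -addrA -[X in _ + X]FD // addNr add0r exy.
    by have := FZ 0 0 (sub0 se); rewrite !scal0 !mul0r => ->; rewrite addr0.
  split; first exact: global_ext_surj.
  split; first exact: GD.
  split; first exact: GZ.
  split=> x hx; have [e [pe ex _]] := common_unit hx hx;
    have [_ _ FS Fsq _] := local_extP pe; have se := mat_subalg n (corner_subalg pe).
    by rewrite /= !(global_extE pe) ?FS //; exact: (subS se).
  by rewrite /= !(global_extE pe) ?Fsq //; exact: (subM se).
move=> phi' [_ [_ [_ [phiD [phiZ _]]]]] agree x hx.
have [e [pe ex _]] := common_unit hx hx; have [lF _ _ _ [_ Fp]] := local_extP pe.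
rewrite (global_extE pe) //; apply: (linear_agree pe _ lF) => //.
  split=> [y z hy hz|k y hy]; [apply: phiD | apply: phiZ]; exact: corner_mat_sub.
by move=> p pp hp; rewrite agree ?Fp.
Qed.

End Dye.

(** * Hilbert space preliminaries *)

Section ComplexReal.
Variable R : realType.
Local Notation C := (R[i]).
Implicit Types (z w : C) (t : R).
Local Notation Re := (@complex.Re R).
Local Notation Im := (@complex.Im R).

Lemma cReD z w : Re (z + w) = Re z + Re w.
Proof. by case: z => a b; case: w. Qed.
Lemma cImD z w : Im (z + w) = Im z + Im w.
Proof. by case: z => a b; case: w. Qed.
Lemma cReM z w : Re (z * w) = Re z * Re w - Im z * Im w.
Proof. by case: z => a b; case: w. Qed.
Lemma cImM z w : Im (z * w) = Re z * Im w + Im z * Re w.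
Proof. by case: z => a b; case: w. Qed.
Lemma cReJ z : Re (z^*) = Re z. Proof. by case: z. Qed.
Lemma cImJ z : Im (z^*) = - Im z. Proof. by case: z. Qed.
Lemma complex_eq z w : Re z = Re w -> Im z = Im w -> z = w.
Proof. by case: z => a b; case: w => c d /= -> ->. Qed.
Lemma complex_ge0 z : (0 <= z) = (Im z == 0) && (0 <= Re z).
Proof. by rewrite lecE. Qed.
Lemma Re_nat m : Re (m%:R) = m%:R.
Proof. by elim: m => [//|m IH]; rewrite -!natr1 cReD IH. Qed.
Lemma Im_nat m : Im (m%:R) = 0.
Proof. by elim: m => [//|m IH]; rewrite -natr1 cImD IH addr0. Qed.

Lemma complex_archimedean : archimedean C.
Proof.
move=> x; rewrite complex_ge0 => /andP[/eqP ix rx].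
have /andP[h1 h2] := truncn_itv rx; exists (Num.truncn (Re x)).
by rewrite lecE ltcE !Re_nat !Im_nat ix eqxx h1 h2.
Qed.

Lemma small_le (a b : R) : (forall e : R, 0 < e -> a <= b + e) -> a <= b.
Proof. by move=> h; apply/ler_addgt0Pr. Qed.
End ComplexReal.

Section Hilbert.
Variables (R : realType) (H : lmodType R[i]) (ip : H -> H -> R[i]).
Hypothesis hH : is_hilbert ip.
Local Notation C := (R[i]).
Local Notation Re := (@complex.Re R).
Local Notation Im := (@complex.Im R).
Implicit Types (x y z : H) (a : C) (t : R).

Lemma ip_linl a x y z : ip (a *: x + y) z = a * ip x z + ip y z.
Proof. by case: hH. Qed.
Lemma ipC x y : ip y x = (ip x y)^*.
Proof. by case: hH. Qed.
Lemma ip_ge0 x : 0 <= ip x x. Proof. by case: hH. Qed.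
Lemma ip_eq0 x : ip x x = 0 -> x = 0. Proof. by case: hH => _ _ _ h _; exact: h. Qed.
Lemma ipDl x y z : ip (x + y) z = ip x z + ip y z.
Proof. by rewrite -[x]scale1r ip_linl mul1r scale1r. Qed.
Lemma ip0l z : ip 0 z = 0.
Proof. by apply: (addrI (ip 0 z)); rewrite -ipDl !addr0. Qed.
Lemma ipZl a x z : ip (a *: x) z = a * ip x z.
Proof. by rewrite -[a *: x]addr0 ip_linl ip0l addr0. Qed.
Lemma ipDr x y z : ip x (y + z) = ip x y + ip x z.
Proof. by rewrite ipC ipDl rmorphD /= -!ipC. Qed.
Lemma ipZr a x z : ip x (a *: z) = a^* * ip x z.
Proof. by rewrite ipC ipZl rmorphM /= -!ipC. Qed.
Lemma ip0r z : ip z 0 = 0.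
Proof. by rewrite ipC ip0l rmorph0. Qed.
Lemma ip_ext x y : (forall z, ip x z = ip y z) -> x = y.
Proof.
move=> h; apply/eqP; rewrite -subr_eq0; apply/eqP; apply: ip_eq0.
by rewrite ipDl -scaleN1r ipZl h mulN1r subrr.
Qed.
Lemma ip_extr x y : (forall z, ip z x = ip z y) -> x = y.
Proof. by move=> h; apply: ip_ext => z; rewrite ipC h -ipC. Qed.

Definition rp x y : R := Re (ip x y).
Definition nsq x : R := rp x x.

Lemma rpC x y : rp x y = rp y x. Proof. by rewrite /rp ipC cReJ. Qed.
Lemma rpDl x y z : rp (x + y) z = rp x z + rp y z. Proof. by rewrite /rp ipDl cReD. Qed.
Lemma rpDr x y z : rp x (y + z) = rp x y + rp x z. Proof. by rewrite /rp ipDr cReD. Qed.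
Lemma rpZl t x z : rp (t%:C%C *: x) z = t * rp x z.
Proof. by rewrite /rp ipZl cReM /= mul0r subr0. Qed.
Lemma rpZr t x z : rp x (t%:C%C *: z) = t * rp x z.
Proof. by rewrite rpC rpZl rpC. Qed.
Lemma rpNl x z : rp (- x) z = - rp x z.
Proof. by apply: (addrI (rp x z)); rewrite -rpDl !subrr /rp ip0l. Qed.
Lemma rpNr x z : rp x (- z) = - rp x z.
Proof. by rewrite rpC rpNl rpC. Qed.
Lemma nsq_ge0 x : 0 <= nsq x.
Proof. by have := ip_ge0 x; rewrite complex_ge0 => /andP[]. Qed.
Lemma ip_nsq x : ip x x = (nsq x)%:C%C.
Proof.
by have := ip_ge0 x; rewrite complex_ge0 => /andP[/eqP h _]; apply: complex_eq.
Qed.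
Lemma nsq_eq0 x : nsq x = 0 -> x = 0.
Proof. by move=> h; apply: ip_eq0; rewrite ip_nsq h. Qed.
Lemma nsqD x y : nsq (x + y) = nsq x + nsq y + 2 * rp x y.
Proof. by rewrite /nsq rpDl !rpDr (rpC y x); ring. Qed.
Lemma nsqB x y : nsq (x - y) = nsq x + nsq y - 2 * rp x y.
Proof. by rewrite nsqD /nsq rpNr rpNl rpNr; ring. Qed.
Lemma nsqZ t x : nsq (t%:C%C *: x) = t ^+ 2 * nsq x.
Proof. by rewrite /nsq rpZl rpZr; ring. Qed.
Lemma rp_i x y : rp ('i%C *: x) y = - Im (ip x y).
Proof. by rewrite /rp ipZl cReM /= mul0r mul1r sub0r. Qed.

(* Riesz representation, by minimizing [x |-> |x|^2 - 2 f x]. *)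
Lemma riesz_real (f : H -> R) (K : R) :
  (forall x y, f (x + y) = f x + f y) -> (forall t x, f (t%:C%C *: x) = t * f x) ->
  (forall x, 2 * f x <= nsq x + K) -> exists z, forall x, f x = rp x z.
Proof.
move=> fD fZ fK; pose F x := nsq x - 2 * f x.
pose S : R -> Prop := fun r => exists x, r = F x.
have S0 : (S !=set0)%classic by exists (F 0), 0.
have Slb : has_lbound S.
  by exists (- K) => _ [x ->]; rewrite /F; have := fK x; lra.
set I := inf S.
have FI x : I <= F x by apply: ge_inf => //; exists x.
have [u hu] : exists u : nat -> H, forall n, F (u n) < I + n.+1%:R^-1.
  apply: (@choice _ _ (fun n x => F x < I + n.+1%:R^-1)) => n.
  have e0 : 0 < n.+1%:R^-1 :> R by rewrite invr_gt0 ltr0n.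
  by have [_ [x ->] h] := inf_adherent e0 (conj S0 Slb); exists x.
(* Parallelogram law, with the infimum as lower bound of [F] at the midpoint; it makes a minimizing
   sequence Cauchy. *)
have par x y : nsq (x - y) <= 2 * (F x - I) + 2 * (F y - I).
  have := FI ((2^-1)%:C%C *: (x + y)).
  rewrite /F nsqZ fZ fD nsqD nsqB; lra.
have [l hl] : exists l, forall e : C, 0 < e -> exists N, forall n, (N <= n)%N ->
    ip (u n - l) (u n - l) < e.
  case: hH => _ _ _ _; apply => e; rewrite ltcE => /andP[/eqP /= ei er].
  have [N hN] : exists N : nat, 4 / Re e < N%:R.
    by exists (Num.bound (4 / Re e)); apply: archi_boundP; rewrite divr_ge0 // ltW.
  exists N => m n Nm Nn; rewrite ip_nsq ltcE /= -ei eqxx /=.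
  have small k : (N <= k)%N -> F (u k) - I < Re e / 4.
    move=> Nk; have := hu k; rewrite -ltrBlDl => /lt_le_trans; apply.
    rewrite -[Re e / 4]invrK lef_pV2 ?posrE ?ltr0n ?invr_gt0 ?divr_gt0 //.
    rewrite invf_div; apply: le_trans (ltW hN) _; rewrite ler_nat; exact: leqW.
  have := par (u m) (u n); have := small _ Nm; have := small _ Nn.
  lra.
exists l => x.
(* Near-minimality of [u n] is tested at [u n + y], and the cross term of [u n - l] with [y] is
   absorbed by their squares. This crude bound is enough: the left side is linear in [y] and the
   right side quadratic, so rescaling removes it. *)
have key y : f y - rp y l <= nsq y.
  apply: small_le => e e0.
  have [N1 hN1] : exists N, forall n, (N <= n)%N -> nsq (u n - l) < e.
    have [|N hN] := hl e%:C%C; first by rewrite ltcE /= eqxx.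
    by exists N => n /hN; rewrite ip_nsq ltcE => /andP[].
  have [N2 hN2] : exists N : nat, 1 / e < N%:R.
    by exists (Num.bound (1 / e)); apply: archi_boundP; rewrite divr_ge0 // ltW.
  pose n := maxn N1 N2.
  have h1 := hN1 n (leq_maxl _ _).
  have h2 : F (u n) - I < e.
    have := hu n; rewrite -ltrBlDl => /lt_le_trans; apply.
    rewrite -[e]invrK lef_pV2 ?posrE ?ltr0n ?invr_gt0 //.
    rewrite -div1r; apply: le_trans (ltW hN2) _; rewrite ler_nat; apply: leqW; exact: leq_maxr.
  have h3 := FI (u n + y); rewrite /F nsqD fD in h3.
  have h4 := nsq_ge0 (u n - l - y); rewrite nsqB rpDl rpNl in h4.
  rewrite /F in h2; rewrite (rpC y l).
  lra.
have neg y : f y - rp y l <= 0.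
  rewrite leNgt; apply/negP => g0.
  set g := f y - rp y l in g0.
  have q0 := nsq_ge0 y; set q := nsq y in q0.
  (* Chosen so that [t * q < g]; the summand 1 covers [q = 0]. *)
  pose t := g / (2 * (q + 1)).
  have t0 : 0 < t by rewrite divr_gt0 // mulr_gt0 //; lra.
  have := key (t%:C%C *: y); rewrite fZ rpZl nsqZ -mulrBr -/g -/q expr2 -mulrA ler_pM2l //.
  rewrite leNgt; apply/negP/negPn.
  have -> : t * q = g * (q / (2 * (q + 1))) by rewrite /t; field; lra.
  rewrite -[ltRHS]mulr1 ltr_pM2l // ltr_pdivrMr; lra.
apply/eqP; rewrite -subr_eq0 eq_le neg /=.
have := neg (- x); rewrite rpNl.
have -> : f (- x) = - f x.
  by apply: (addrI (f x)); rewrite -fD !subrr -(scale0r 0) (fZ 0) mul0r.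
lra.
Qed.

Lemma bounded_nsq T : bounded_linear ip T -> exists2 m : R, 0 < m & forall x, nsq (T x) <= m * nsq x.
Proof.
move=> [_ [M hM]]; exists (`|Re M| + 1); first by rewrite ltr_wpDl.
move=> x; have := hM x; rewrite !ip_nsq lecE cReM /= mulr0 subr0 => /andP[_ h].
apply: le_trans h _; rewrite ler_wpM2r ?nsq_ge0 //.
by rewrite (le_trans (ler_norm _)) // lerDl.
Qed.

(** [riesz_real] is applied to the real part of [ip (T x) y], with the bound coming from
    [0 <= |T x - m y|^2]. Replacing [x] by [i x] recovers the imaginary part. *)
Lemma bounded_adjoint T : bounded_linear ip T -> exists S, forall x y, ip (T x) y = ip x (S y).
Proof.
move=> bT; have [m m0 hm] := bounded_nsq bT; have [lT _] := bT.
have TD x y : T (x + y) = T x + T y by rewrite -[x]scale1r lT !scale1r.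
have T0 : T 0 = 0 by apply: (addrI (T 0)); rewrite -TD !addr0.
have TZ a x : T (a *: x) = a *: T x by rewrite -[a *: x]addr0 lT T0 addr0.
suff h y : exists z, forall x, ip (T x) y = ip x z.
  by have [S hS] := @choice _ _ (fun y z => forall x, ip (T x) y = ip x z) h; exists S.
have [| | |z hz] := @riesz_real (fun x => rp (T x) y) (m * nsq y).
- by move=> x x'; rewrite TD rpDl.
- by move=> t x; rewrite TZ rpZl.
- move=> x; have h1 := hm x.
  have h2 := nsq_ge0 (T x - m%:C%C *: y); rewrite nsqB nsqZ rpZr in h2.
  have : 2 * m * rp (T x) y <= m * (nsq x + m * nsq y) by nra.
  by rewrite [2 * m]mulrC -mulrA ler_pM2l.
exists z => x; apply: complex_eq; first exact: hz.
by have := hz ('i%C *: x); rewrite TZ !rp_i => /oppr_inj.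
Qed.
End Hilbert.

(** * The involutive algebra of adjointable operators *)

(* Carrying the adjoint along makes the involution a swap; linearity follows from [opP]. *)
Record adjop (R : realType) (H : lmodType R[i]) (ip : H -> H -> R[i]) (hH : is_hilbert ip) := AdjOp {
  opf :> H -> H;
  opadj : H -> H;
  opP : forall x y, ip (opf x) y = ip x (opadj y) }.

Section Operators.
Variables (R : realType) (H : lmodType R[i]) (ip : H -> H -> R[i]) (hH : is_hilbert ip).
Local Notation C := (R[i]).
Local Notation op := (adjop hH).
Implicit Types (S T : op) (x y z : H) (a : C).

Lemma op_ext S T : (forall x, S x = T x) -> S = T.
Proof.
case: S => f f' hf; case: T => g g' hg /= e.
have e1 : f = g by apply/funext.
have e2 : f' = g'.
  by apply/funext => y; apply: (ip_extr hH) => x; rewrite -hf -hg e1.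
by subst f' f; congr AdjOp; exact: Prop_irrelevance.
Qed.

Lemma adjP T x y : ip (opadj T x) y = ip x (T y).
Proof. by rewrite (ipC hH) -opP -(ipC hH). Qed.

Lemma op_lin T a x y : T (a *: x + y) = a *: T x + T y.
Proof.
by apply: (ip_ext hH) => z; rewrite opP !(ipDl hH) !(ipZl hH) -!opP.
Qed.
Lemma opD T x y : T (x + y) = T x + T y.
Proof. by rewrite -[x]scale1r op_lin !scale1r. Qed.
Lemma op0 T : T 0 = 0.
Proof. by apply: (addrI (T 0)); rewrite -opD !addr0. Qed.
Lemma opZ T a x : T (a *: x) = a *: T x.
Proof. by rewrite -[a *: x]addr0 op_lin op0 addr0. Qed.

#[local] Obligation Tactic := idtac.
Program Definition op_zero : op := @AdjOp _ _ _ hH (fun=> 0) (fun=> 0) _.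
Next Obligation. by move=> x y; rewrite (ip0l hH) (ip0r hH). Qed.
Program Definition op_one : op := @AdjOp _ _ _ hH id id _.
Next Obligation. by []. Qed.
Program Definition op_add S T : op :=
  @AdjOp _ _ _ hH (fun x => S x + T x) (fun x => opadj S x + opadj T x) _.
Next Obligation. by move=> S T x y; rewrite (ipDl hH) (ipDr hH) !opP. Qed.
Program Definition op_scale a T : op :=
  @AdjOp _ _ _ hH (fun x => a *: T x) (fun x => a^* *: opadj T x) _.
Next Obligation. by move=> a T x y; rewrite (ipZl hH) (ipZr hH) conjCK opP. Qed.
Program Definition op_mul S T : op := @AdjOp _ _ _ hH (S \o T) (opadj T \o opadj S) _.
Next Obligation. by move=> S T x y; rewrite /= !opP. Qed.
Program Definition op_star T : op := @AdjOp _ _ _ hH (opadj T) T _.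
Next Obligation. by move=> T x y; exact: adjP. Qed.

HB.instance Definition _ := gen_eqMixin op.
HB.instance Definition _ := gen_choiceMixin op.

Lemma op_addA : associative op_add.
Proof. by move=> S T U; apply: op_ext => x /=; rewrite addrA. Qed.
Lemma op_addC : commutative op_add.
Proof. by move=> S T; apply: op_ext => x /=; rewrite addrC. Qed.
Lemma op_add0 : left_id op_zero op_add.
Proof. by move=> S; apply: op_ext => x /=; rewrite add0r. Qed.
Lemma op_addN : left_inverse op_zero (op_scale (-1)) op_add.
Proof. by move=> S; apply: op_ext => x /=; rewrite scaleN1r addNr. Qed.
HB.instance Definition _ := GRing.isZmodule.Build op op_addA op_addC op_add0 op_addN.

Lemma op_mulA : associative op_mul.
Proof. by move=> S T U; apply: op_ext. Qed.
Lemma op_mul1 : left_id op_one op_mul.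
Proof. by move=> S; apply: op_ext. Qed.
Lemma op_mulr1 : right_id op_one op_mul.
Proof. by move=> S; apply: op_ext. Qed.
Lemma op_mulDl : left_distributive op_mul op_add.
Proof. by move=> S T U; apply: op_ext. Qed.
Lemma op_mulDr : right_distributive op_mul op_add.
Proof. by move=> S T U; apply: op_ext => x /=; rewrite opD. Qed.
HB.instance Definition _ := GRing.Zmodule_isPzRing.Build op op_mulA op_mul1 op_mulr1 op_mulDl op_mulDr.

Definition op_scal a : op := op_scale a op_one.

Lemma op_starD S T : op_star (S + T) = op_star S + op_star T.
Proof. exact: op_ext. Qed.
Lemma op_starM S T : op_star (S * T) = op_star T * op_star S.
Proof. exact: op_ext. Qed.
Lemma op_starK : involutive op_star.
Proof. by move=> S; apply: op_ext. Qed.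
Lemma op_scalD a b : op_scal (a + b) = op_scal a + op_scal b.
Proof. by apply: op_ext => x /=; rewrite scalerDl. Qed.
Lemma op_scalM a b : op_scal (a * b) = op_scal a * op_scal b.
Proof. by apply: op_ext => x /=; rewrite scalerA. Qed.
Lemma op_scal1 : op_scal 1 = 1.
Proof. by apply: op_ext => x /=; rewrite scale1r. Qed.
Lemma op_scalC a T : op_scal a * T = T * op_scal a.
Proof. by apply: op_ext => x /=; rewrite opZ. Qed.
Lemma op_star_scal a : op_star (op_scal a) = op_scal a^*.
Proof. exact: op_ext. Qed.

Definition opalg : staralg C :=
  @StarAlg C (adjop hH : pzRingType) op_star op_scal op_starD op_starM op_starK
    op_scalD op_scalM op_scal1 op_scalC op_star_scal.

Lemma op_addE (S T : opalg) x : opf (S + T) x = opf S x + opf T x. Proof. by []. Qed.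
Lemma op_oppE (T : opalg) x : opf (- T) x = - opf T x.
Proof. by rewrite /= scaleN1r. Qed.
Lemma op_sumE I (r : seq I) (F : I -> opalg) x :
  opf (\sum_(i <- r) F i) x = \sum_(i <- r) opf (F i) x.
Proof. by apply: (big_morph (fun T : opalg => opf T x)). Qed.
Lemma op_mulrnE (T : opalg) m x : opf (T *+ m) x = opf T x *+ m.
Proof. by elim: m => [//|m IH]; rewrite !mulrS op_addE IH. Qed.

Lemma ip_suml I (r : seq I) (F : I -> H) z : ip (\sum_(i <- r) F i) z = \sum_(i <- r) ip (F i) z.
Proof. by apply: (big_morph (fun x => ip x z)) => [x y|]; [exact: (ipDl hH) | exact: (ip0l hH)]. Qed.

Lemma opalg_posdef : posdef opalg.
Proof.
move=> m x h i; apply: op_ext => v.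
have e : \sum_(i < m) ip (opf (x i) v) (opf (x i) v) = 0.
  transitivity (ip (opf (\sum_i star (x i) * x i) v) v).
    by rewrite op_sumE ip_suml; apply: eq_bigr => j _; exact: (esym (adjP (x j) (opf (x j) v) v)).
  by rewrite h; exact: (ip0l hH).
apply: (ip_eq0 hH); apply: (psumr_eq0P _ e) => // j _; exact: (ip_ge0 hH).
Qed.

Definition op_pos (T : opalg) := forall x, 0 <= ip (opf T x) x.

(** Polarization at [x, y] and at [x, i y] separates the two sesquilinear terms. *)
Lemma op_quad_eq0 (T : opalg) : (forall x, ip (opf T x) x = 0) -> T = 0.
Proof.
move=> h; apply: op_ext => x; apply: (ip_ext hH) => y; rewrite (ip0l hH).
have pol u v : ip (opf T u) v + ip (opf T v) u = 0.
  have := h (u + v); rewrite opD !(ipDl hH) !(ipDr hH) !h addr0 add0r.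
  by [].
have h1 := pol x y; have := pol x ('i *: y).
rewrite opZ (ipZr hH) (ipZl hH) conjCi mulNr addrC -mulrBr => /eqP.
rewrite mulf_eq0 (negPf (neq0Ci _)) /= subr_eq0 => /eqP e.
move: h1; rewrite e -mulr2n => /eqP; rewrite mulrn_eq0 /= => /eqP <-.
by [].
Qed.

Lemma op_pos_cone : positive_cone op_pos.
Proof.
split.
- by move=> T x; rewrite -[ip _ _]/(ip (opadj T (opf T x)) x) adjP; exact: (ip_ge0 hH).
- by move=> S T hS hT x; rewrite op_addE (ipDl hH) addr_ge0.
- move=> S T h; apply: op_quad_eq0 => x.
  have h' m : 0 <= ip (opf S x) x - ip (opf T x) x *+ m /\ 0 <= ip (opf S x) x + ip (opf T x) x *+ m.
    have [h1 h2] := h m; have := h1 x; have := h2 x.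
    rewrite !op_addE op_oppE !op_mulrnE !(ipDl hH) -scaleN1r (ipZl hH) mulN1r.
    have -> : ip (opf T x *+ m) x = ip (opf T x) x *+ m.
      by elim: m {h1 h2} => [|m IH]; rewrite ?mulr0n ?(ip0l hH) // !mulrS (ipDl hH) IH.
    by [].
  move: (ip (opf S x) x) (ip (opf T x) x) h' => s t h'.
  (* The cases [m = 0] and [m = 1] force [s] and [t] to be real; the Archimedean property then
     applies to their real parts. *)
  have [_ ] := h' 0%N; rewrite mulr0n addr0 complex_ge0 => /andP[/eqP is0 rs0].
  have [_ ] := h' 1%N; rewrite complex_ge0 cImD is0 add0r => /andP[/eqP it0 _].
  apply: complex_eq; rewrite //=.
  have rmn m : complex.Re (t *+ m) = complex.Re t *+ m.
    by elim: m => [//|m IH]; rewrite !mulrS cReD IH.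
  have rN (z : C) : complex.Re (- z) = - complex.Re z by case: z.
  have h2 m : complex.Re t *+ m <= complex.Re s /\ - complex.Re s <= complex.Re t *+ m.
    have [] := h' m; rewrite !complex_ge0 !cReD rN rmn => /andP[_ k1] /andP[_ k2].
    by split; lra.
  apply/eqP; apply/negPn/negP => nz.
  have pr : 0 < `|complex.Re t| by rewrite normr_gt0.
  have := archi_boundP (divr_ge0 rs0 (ltW pr)); set m := Num.bound _.
  rewrite ltr_pdivrMr // => hm; have [k1 k2] := h2 m.
  move: hm; rewrite mulr_natl; apply/negP; rewrite -leNgt -normrMn ler_norml k1 andbT.
  by lra.
Qed.
End Operators.

(** * Operators with finite spectrum *)

(** The polynomial [p * p - m] splits over an algebraically closed field, and evaluation at [h] is a
    ring morphism because scalars commute with [h]. It is nonzero since its value at 0 is [- m]. *)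
Lemma factor_square (C : closedFieldType) (S : nzRingType) (f : {rmorphism C -> S}) (h : S)
    (s : seq C) (m : C) : m != 0 -> (forall a, GRing.comm (f a) h) ->
  exists (c : C) (rs : seq C),
    [/\ c != 0, (h * \prod_(l <- s) (h - f l)) * (h * \prod_(l <- s) (h - f l)) - f m =
        f c * \prod_(r <- rs) (h - f r) &
        {in rs, forall r, (r * \prod_(l <- s) (r - l)) ^+ 2 = m}].
Proof.
move=> m0 fh; have cfh : commr_rmorph f h by move=> a; apply/commr_sym/fh.
pose p : {poly C} := 'X * \prod_(l <- s) ('X - l%:P).
pose q := p * p - m%:P; have [rs e] := closed_field_poly_normal q.
have pr r : p.[r] = r * \prod_(l <- s) (r - l).
  rewrite hornerM hornerX horner_prod; congr (_ * _); apply: eq_bigr => l _.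
  by rewrite hornerXsubC.
have q0 : q != 0.
  apply: contra_neq m0 => /(congr1 (horner^~ 0)).
  rewrite hornerD hornerN hornerC hornerM pr horner0 !mul0r sub0r => /eqP.
  by rewrite oppr_eq0 => /eqP.
exists (lead_coef q), rs; split; first by rewrite lead_coef_eq0.
  have hX : horner_morph cfh 'X = h by rewrite horner_morphX.
  have hC a : horner_morph cfh a%:P = f a by rewrite horner_morphC.
  have hp : horner_morph cfh p = h * \prod_(l <- s) (h - f l).
    rewrite rmorphM /= hX rmorph_prod; congr (_ * _); apply: eq_bigr => l _.
    by rewrite rmorphB /= hX hC.
  have := congr1 (horner_morph cfh) e; rewrite rmorphB rmorphM /= hp hC => ->.
  rewrite -mul_polyC rmorphM /= hC rmorph_prod; congr (_ * _); apply: eq_bigr => l _.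
  by rewrite rmorphB /= hX hC.
move=> r rrs; have : root q r.
  by rewrite e rootZ ?lead_coef_eq0 // root_prod_XsubC.
by rewrite /root hornerD hornerN hornerC hornerM pr subr_eq0 expr2 => /eqP.
Qed.

(** A [staralg] may be the zero ring while [factor_square] asks for a nonzero one; the assumption
    [1 != 0] is packed into such a structure on the same carrier. *)
Lemma annihilator_square (C : numClosedFieldType) (L : staralg C) (h : L) (s : seq C) (m : C) :
    (1 : L) != 0 -> m != 0 ->
  exists (c : C) (rs : seq C),
    [/\ c != 0, (h * annihilator h s) * (h * annihilator h s) - scal L m =
        scal L c * \prod_(r <- rs) (h - scal L r) &
        {in rs, forall r, (r * \prod_(l <- s) (r - l)) ^+ 2 = m}].
Proof.
move=> nz m0.
pose S : nzRingType := HB.pack_for nzRingType (car L)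
  (GRing.PzSemiRing_isNonZero.Build (car L) nz).
have fB : zmod_morphism (scal L : C -> S) by move=> a b; rewrite scalD scalN.
have fM : monoid_morphism (scal L : C -> S) by split; [exact: scal1 | exact: scalM].
pose f : {rmorphism C -> S} := HB.pack_for {rmorphism C -> S} (scal L : C -> S)
  (GRing.isZmodMorphism.Build C S (scal L : C -> S) fB)
  (GRing.isMonoidMorphism.Build C S (scal L : C -> S) fM).
exact: (@factor_square C S f h s m m0 (fun a => scalC a h)).
Qed.

Section FiniteSpectrum.
Variables (R : realType) (H : lmodType R[i]) (ip : H -> H -> R[i]).
Hypothesis hH : is_hilbert ip.
Local Notation C := (R[i]).
Local Notation op := (opalg hH).
Local Notation nrm2 := (nsq ip).
Implicit Types (T : op) (x y : H).

Definition bounded_below T := exists k : R, forall x, nrm2 x <= k * nrm2 (opf T x).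

Lemma bounded_below_mul S T : bounded_below S -> bounded_below T -> bounded_below (S * T).
Proof.
move=> [k hk] [l hl]; exists (`|l| * k) => x.
have h1 := hl x; have h2 := hk (opf T x); rewrite /= in h1 h2 *.
apply: (le_trans h1); rewrite -mulrA; apply: le_trans (_ : `|l| * nrm2 (opf T x) <= _).
  by rewrite ler_wpM2r ?(nsq_ge0 hH) // ler_norm.
by rewrite ler_wpM2l.
Qed.

Lemma nsq_scale (c : C) x : nrm2 (c *: x) = (complex.Re c ^+ 2 + complex.Im c ^+ 2) * nrm2 x.
Proof.
rewrite /nsq /rp (ipZl hH) (ipZr hH) !cReM !cImM cReJ cImJ (ip_nsq hH) /=.
ring.
Qed.

Lemma bounded_below_scal (c : C) : c != 0 -> bounded_below (scal op c).
Proof.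
move=> c0; exists (complex.Re c^-1 ^+ 2 + complex.Im c^-1 ^+ 2) => x.
by rewrite -nsq_scale /= scalerA mulVf // scale1r.
Qed.

Lemma bounded_below_prod (h : op) (rs : seq C) :
  {in rs, forall r, bounded_below (h - scal op r)} ->
  bounded_below (\prod_(r <- rs) (h - scal op r)).
Proof.
elim: rs => [_|r rs IH hr].
  by rewrite big_nil; exists 1 => x; rewrite mul1r.
rewrite big_cons; apply: bounded_below_mul; first by apply: hr; rewrite inE eqxx.
by apply: IH => t ht; apply: hr; rewrite inE ht orbT.
Qed.

(** For [r = a + i b] the cross term vanishes by self-adjointness, so [|(h - r) x|^2 = |(h - a) x|^2
    + b^2 |x|^2]. *)
Lemma bounded_below_nonreal (h : op) (r : C) : star h = h -> complex.Im r != 0 ->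
  bounded_below (h - scal op r).
Proof.
move=> sh r0; exists ((complex.Im r ^+ 2)^-1) => x.
rewrite ler_pdivlMl ?exprn_even_gt0 //.
set a := complex.Re r; set b := complex.Im r.
have e : opf (h - scal op r) x = (opf h x - a%:C%C *: x) - b%:C%C *: ('i%C *: x).
  rewrite op_addE op_oppE /= -addrA -opprD scalerA -scalerDl; congr (_ - _ *: _).
  by rewrite /a /b; case: (r) => u v; simpc.
have sym : complex.Im (ip (opf h x) x) = 0.
  have : ip (opf h x) x = (ip (opf h x) x)^*.
    by rewrite -(ipC hH) -{1}sh; exact: (adjP h).
  move/(congr1 (@complex.Im R)); rewrite cImJ => /eqP.
  by rewrite -addr_eq0 -mulr2n mulrn_eq0 /= => /eqP.
rewrite e nsqB // nsqZ // nsqB // nsqZ //.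
rewrite (rpDl hH) (rpNl hH) !(rpZl hH) !(rpZr hH) (rpC hH _ ('i%C *: x)) (rp_i hH).
rewrite (rpC hH x) (rp_i hH).
have -> : complex.Im (ip x x) = 0 by rewrite (ip_nsq hH).
have -> : complex.Im (ip x (opf h x)) = 0 by rewrite (ipC hH) cImJ sym oppr0.
rewrite nsq_scale /= expr0n /= add0r expr1n mul1r.
have := nsq_ge0 hH (opf h x - a%:C%C *: x); rewrite nsqB // nsqZ //.
rewrite (rpZr hH); lra.
Qed.

Section Rstar.
Variable A : (H -> H) -> Prop.
Hypothesis hA : Rstar_algebra ip A.
Definition lift_sub : op -> Prop := fun T => A (opf T).

Lemma adj_op T : adj ip (opf T) = opadj T.
Proof.
have h : exists S, forall x y, ip (opf T x) y = ip x (S y) by exists (opadj T); exact: opP.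
have h' := epsilon_spec (inhabits (fun _ => 0)) _ h; rewrite -/(adj ip (opf T)) in h'.
by apply/funext => y; apply: (ip_extr hH) => x; rewrite -h' opP.
Qed.

Lemma lift_subalg : subalg lift_sub.
Proof.
case: hA => [_ [A0 [AD [AZ [AM [AS _]]]]]]; split=> //.
- by move=> S T hS hT; exact: AD.
- by move=> S T hS hT; exact: AM.
- by move=> T hT; have := AS _ hT; rewrite adj_op.
- by move=> k T hT; exact: AZ.
Qed.

Lemma lift_op f : A f -> exists T : op, opf T = f.
Proof.
case: hA => [Ab _] /Ab bf; have [S hS] := bounded_adjoint hH bf.
by exists (AdjOp hH hS).
Qed.

(* If [Q = h (h - l1) ... (h - lk)] were nonzero, let [m > 0] be the least constant with
   [|Q x|^2 <= m |x|^2]: then [Q^2 - m] is not bounded below, whereas all its linear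
   factors [h - r] are, because a spectral value [r] of [h] satisfies [Q(r) = 0]. *)
Lemma rstar_annihilated : annihilated lift_sub.
Proof.
move=> h Ah sh; have hs : adj ip (opf h) = opf h by rewrite adj_op -[in RHS]sh.
case: (hA) => [Ab [_ [_ [_ [_ [_ fin]]]]]]; have [s0 hs0] := fin _ Ah hs.
(* Non-real values may be dropped by [bounded_below_nonreal], and the value 0 is carried by the
   separate factor [h]. *)
pose s := [seq l <- s0 | (l \is Num.real) && (l != 0)].
have sreal : all (fun l => (l \is Num.real) && (l != 0)) s.
  by apply/allP => l; rewrite mem_filter => /andP[].
exists s => //; have sr : all (fun l => l \is Num.real) s by apply: sub_all sreal => l /andP[].
have [AQ0 sQ0] := annihilator_mul lift_subalg Ah sh sr.
have [Q eQ] : exists Q : op, Q = h * annihilator h s by eexists.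
rewrite -eQ in AQ0 sQ0 *.
have [m1 m10 hm1] := bounded_nsq hH (Ab _ AQ0).
apply: contrapT => Q0.
have [v Qv] : exists v, opf Q v != 0.
  apply: contrapT => nv; apply: Q0; apply: op_ext => v.
  by apply/eqP; apply/negPn/negP => h0; apply: nv; exists v.
have qv : 0 < nrm2 v.
  rewrite lt_neqAle (nsq_ge0 hH) andbT eq_sym; apply: contra_neq Qv => /(nsq_eq0 hH) ->.
  exact: op0.
have qQv : 0 < nrm2 (opf Q v).
  by rewrite lt_neqAle (nsq_ge0 hH) andbT eq_sym; apply: contra_neq Qv => /(nsq_eq0 hH).
pose S : R -> Prop := fun c => forall x, nrm2 (opf Q x) <= c * nrm2 x.
have Slb c : S c -> nrm2 (opf Q v) / nrm2 v <= c by move=> /(_ v); rewrite ler_pdivrMr.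
have S0 : (S !=set0)%classic by exists m1.
have hlb : has_lbound S by exists (nrm2 (opf Q v) / nrm2 v).
pose m := inf S.
have m0 : 0 < m by apply: lt_le_trans (lb_le_inf S0 Slb); rewrite divr_gt0.
have Sm : S m.
  move=> x; apply: small_le => e e0; have q0 := nsq_ge0 hH x.
  have e1 : 0 < e / (nrm2 x + 1) by rewrite divr_gt0 // ltr_wpDl.
  have [c Sc hc] := inf_adherent e1 (conj S0 hlb).
  apply: le_trans (Sc x) _; apply: le_trans (_ : (m + e / (nrm2 x + 1)) * nrm2 x <= _).
    by rewrite ler_wpM2r // ltW.
  rewrite mulrDl lerD2l mulrAC -mulrA ler_piMr ?(ltW e0) // ler_pdivrMr ?ltr_wpDl // mul1r.
  by rewrite lerDl.
have [k hk] : bounded_below (Q * Q - scal op m%:C%C).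
  have nz1 : (1 : op) != 0.
    by apply/eqP => /(congr1 (fun T => opf (T * Q) v)) /eqP; rewrite mul1r mul0r (negPf Qv).
  have mc0 : m%:C%C != 0 by apply: contra_neq (lt0r_neq0 m0) => /(congr1 (@complex.Re R)).
  have [c [rs [c0 e hrs]]] := annihilator_square h s nz1 mc0.
  rewrite -eQ in e; rewrite e; apply: bounded_below_mul; first exact: bounded_below_scal.
  (* The polynomial of [Q] takes at [r] a value with square [m], so [r] is neither 0 nor in [s]. If
     real, it is outside the spectrum, and the bounded inverse of [h - r] gives the bound. *)
  apply: bounded_below_prod => r rrs; have pr := hrs r rrs.
  have r0 : r != 0.
    by apply: contra_neq mc0 => r0; rewrite -pr r0 mul0r expr0n.
  have [ri|ri] := eqVneq (complex.Im r) 0; last exact: bounded_below_nonreal.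
  have rs' : r \notin s.
    apply/negP => rs'; move/eqP: mc0; apply; rewrite -pr (big_rem r) //= subrr mul0r mulr0.
    by rewrite expr0n.
  have rreal : r \is Num.real.
    by rewrite realE !lecE /= ri eqxx /= le_total.
  have [S0' hS0'] : exists S0, bounded_linear ip S0 /\
      (forall x, S0 (opf h x - r *: x) = x) /\ (forall x, opf h (S0 x) - r *: S0 x = x).
    apply: contrapT => ns; move: rs'; rewrite mem_filter rreal r0 /= => /negP; apply.
    exact: hs0.
  have [bS0 [S01 _]] := hS0'; have [k k0 hk] := bounded_nsq hH bS0.
  exists k => x; apply: le_trans (hk _); rewrite op_addE op_oppE -[opf (scal op r) x]/(r *: x).
  by rewrite S01.
(* In the expanded square, [|Q (Q x)|^2] is at most [m |Q x|^2], and self-adjointness turns the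
   cross term into [- 2 m |Q x|^2]. *)
have hQ x : nrm2 (opf (Q * Q - scal op m%:C%C) x) <= m * (m * nrm2 x - nrm2 (opf Q x)).
  have -> : opf (Q * Q - scal op m%:C%C) x = opf Q (opf Q x) - m%:C%C *: x.
    by rewrite op_addE op_oppE.
  rewrite nsqB // nsqZ // (rpZr hH).
  have -> : rp ip (opf Q (opf Q x)) x = nrm2 (opf Q x).
    have sf y : opadj Q y = opf Q y by rewrite -[in RHS]sQ0.
    by rewrite /nsq /rp -{1}sf adjP.
  have := Sm (opf Q x); set a := nrm2 _; set b := nrm2 _; lra.
have k1 : 0 < `|k| + 1 by rewrite ltr_wpDl.
(* Both bounds together give [|x|^2 <= (|k| + 1) m (m |x|^2 - |Q x|^2)]. Solved for [|Q x|^2], this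
   is a constant strictly below the infimum [m]. *)
have : S (m - ((`|k| + 1) * m)^-1).
  move=> x; have h1 := hk x; have h2 := hQ x; have q0 := nsq_ge0 hH (opf (Q * Q - scal op m%:C%C) x).
  have h3 : nrm2 x <= (`|k| + 1) * (m * (m * nrm2 x - nrm2 (opf Q x))).
    apply: (le_trans h1); apply: le_trans (_ : (`|k| + 1) * nrm2 (opf (Q * Q - scal op m%:C%C) x) <= _).
      by rewrite ler_wpM2r // (le_trans (ler_norm k)) // lerDl.
    by rewrite ler_pM2l.
  rewrite mulrA in h3; rewrite mulrBl lerBrDr -lerBrDl ler_pdivrMl ?mulr_gt0 //.
move/(ge_inf hlb); rewrite -/m leNgt => /negP; apply.
by rewrite ltrBlDr ltrDl invr_gt0 mulr_gt0.
Qed.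
End Rstar.
End FiniteSpectrum.
Arguments lift_sub {R H ip} hH A _.

(** * Transfer to the concrete operator algebras *)

(** [opsAlg] consists of all functions [H -> H], which need not form a ring, so results are carried
    along [v] from [adjop]. Preimages are asked only for members of [X], since an arbitrary function
    need not have an adjoint. *)
Record represents (C : Type) (S' S : salg C) (X' : S' -> Prop) (X : S -> Prop) (v : S' -> S) : Prop := {
  rep_inj : injective v;
  rep0 : v (s0 S') = s0 S;
  repD : forall x y, v (sadd x y) = sadd (v x) (v y);
  repZ : forall a x, v (sscale a x) = sscale a (v x);
  repM : forall x y, v (smul x y) = smul (v x) (v y);
  repS : forall x, v (sstar x) = sstar (v x);
  rep_mem : forall x, X' x <-> X (v x);
  rep_onto : forall x, X x -> exists x', v x' = x }.

Section Transfer.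
Variables (C : Type) (S' S T' T : salg C).
Variables (X' : S' -> Prop) (X : S -> Prop) (Y' : T' -> Prop) (Y : T -> Prop).
Variables (v : S' -> S) (w : T' -> T).
Hypotheses (rv : represents X' X v) (rw : represents Y' Y w).
Hypotheses (XD : forall x y, X' x -> X' y -> X' (sadd x y)) (XZ : forall a x, X' x -> X' (sscale a x)).
Hypotheses (XM : forall x y, X' x -> X' y -> X' (smul x y)) (XS : forall x, X' x -> X' (sstar x)).

Lemma rep_is_proj (Q' Q : salg C) (Z' : Q' -> Prop) (Z : Q -> Prop) (u : Q' -> Q) p :
  represents Z' Z u -> is_proj Z' p <-> is_proj Z (u p).
Proof.
move=> ru; split=> -[h1 h2 h3]; split.
- exact/(rep_mem ru).
- by rewrite -(repM ru) h2.
- by rewrite -(repS ru) h3.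
- exact/(rep_mem ru).
- by apply: (rep_inj ru); rewrite (repM ru).
- by apply: (rep_inj ru); rewrite (repS ru).
Qed.

Lemma rep_onto_mem (Q' Q : salg C) (Z' : Q' -> Prop) (Z : Q -> Prop) (u : Q' -> Q) x :
  represents Z' Z u -> Z x -> exists2 x', Z' x' & u x' = x.
Proof. by move=> ru Zx; have [x' e] := rep_onto ru Zx; exists x' => //; apply/(rep_mem ru); rewrite e. Qed.

Section Jordan.
Variables (F' : S' -> T') (F : S -> T).
Hypothesis FE : forall x, X' x -> F (v x) = w (F' x).

Lemma jordan_rep : jordan_star_iso X' Y' F' <-> jordan_star_iso X Y F.
Proof.
split=> -[FY [Finj [Fsurj [FD [FZ [FS Fsq]]]]]].
  have up x : X x -> exists2 x', X' x' & v x' = x by exact: rep_onto_mem.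
  split; first by move=> _ /up[x hx <-]; rewrite FE //; apply/(rep_mem rw)/FY.
  split.
    move=> _ _ /up[x hx <-] /up[y hy <-]; rewrite !FE // => /(rep_inj rw) h.
    by rewrite (Finj x y).
  split.
    move=> y0 hy0; have [y hy <-] := rep_onto_mem rw hy0; have [x hx <-] := Fsurj y hy.
    by exists (v x); [exact/(rep_mem rv) | rewrite FE].
  split.
    move=> _ _ /up[x hx <-] /up[y hy <-]; rewrite -(repD rv) !FE //; last exact: XD.
    by rewrite FD // (repD rw).
  split.
    move=> a _ /up[x hx <-]; rewrite -(repZ rv) !FE //; last exact: XZ.
    by rewrite FZ // (repZ rw).
  split=> _ /up[x hx <-].
    rewrite -(repS rv) !FE //; last exact: XS.
    by rewrite FS // (repS rw).
  rewrite -(repM rv) !FE //; last exact: XM.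
  by rewrite Fsq // (repM rw).
have dn x : X' x -> X (v x) by move/(rep_mem rv).
split; first by move=> x hx; apply/(rep_mem rw); rewrite -FE //; apply/FY/dn.
split.
  move=> x y hx hy h; apply: (rep_inj rv); apply: Finj; try exact: dn.
  by rewrite !FE // h.
split.
  move=> y hy; have [x0 hx0 e] := Fsurj (w y) ((rep_mem rw y).1 hy).
  have [x hx ex] := rep_onto_mem rv hx0; exists x => //.
  by apply: (rep_inj rw); rewrite -FE // ex e.
split.
  move=> x y hx hy; apply: (rep_inj rw); rewrite (repD rw) -!FE //; last exact: XD.
  by rewrite (repD rv) FD //; exact: dn.
split.
  move=> a x hx; apply: (rep_inj rw); rewrite (repZ rw) -!FE //; last exact: XZ.
  by rewrite (repZ rv) FZ //; exact: dn.
split=> x hx; apply: (rep_inj rw).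
  by rewrite (repS rw) -!FE ?(repS rv) ?FS //; [exact: dn | exact: XS].
by rewrite (repM rw) -!FE ?(repM rv) ?Fsq //; [exact: dn | exact: XM].
Qed.
End Jordan.

Section Ortho.
Variables (F' : S' -> T') (F : S -> T).
Hypothesis FE : forall p, is_proj X' p -> F (v p) = w (F' p).

Lemma orthoiso_rep : orthoiso X' Y' F' <-> orthoiso X Y F.
Proof.
have up p : is_proj X p -> exists2 p', is_proj X' p' & v p' = p.
  move=> pp; have [Xp _ _] := pp; have [p' _ e] := rep_onto_mem rv Xp.
  by exists p' => //; apply/(rep_is_proj _ rv); rewrite e.
split=> -[h1 h2 h3]; split.
- by move=> _ /up[p pp <-]; rewrite FE //; apply/(rep_is_proj _ rw)/h1.
- move=> q0 pq0; have [Yq _ _] := pq0; have [q _ e] := rep_onto_mem rw Yq.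
  have pq : is_proj Y' q by apply/(rep_is_proj _ rw); rewrite e.
  have [p [[pp ep] up1]] := h2 q pq; exists (v p); split.
    by split; [exact/(rep_is_proj _ rv) | rewrite FE // ep].
  move=> _ [/up[r pr <-]]; rewrite FE // -e => /(rep_inj rw) er.
  by rewrite (up1 r).
- move=> _ _ /up[p pp <-] /up[q pq <-]; rewrite !FE // -(repM rv) -(repM rw) -(rep0 rv) -(rep0 rw).
  split=> [/(rep_inj rv)|/(rep_inj rw)] h; [apply: (congr1 w) | apply: (congr1 v)]; exact/h3.
- by move=> p pp; apply/(rep_is_proj _ rw); rewrite -FE //; apply/h1/(rep_is_proj _ rv).
- move=> q pq; have [p0 [[pp0 ep] up1]] := h2 (w q) ((rep_is_proj q rw).1 pq).
  have [p pp e] := up _ pp0; exists p; split.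
    by split => //; apply: (rep_inj rw); rewrite -FE // e.
  move=> r [pr er]; apply: (rep_inj rv); rewrite e; apply: up1; split; last by rewrite FE // er.
  exact/(rep_is_proj _ rv).
- move=> p q pp pq; have := h3 _ _ ((rep_is_proj p rv).1 pp) ((rep_is_proj q rv).1 pq).
  rewrite !FE // -(repM rv) -(repM rw) -(rep0 rv) -(rep0 rw) => h.
  split=> [/(congr1 v)|/(congr1 w)] k; [apply: (rep_inj rw) | apply: (rep_inj rv)]; exact/h.
Qed.
End Ortho.
End Transfer.

Section OperatorTransfer.
Variables (R : realType) (H : lmodType R[i]) (ip : H -> H -> R[i]) (hH : is_hilbert ip).
Variables (A : opsAlg ip -> Prop) (hA : Rstar_algebra ip A).

Lemma op_represents :
  represents (S' := alg (opalg hH)) (S := opsAlg ip) (lift_sub hH A) A (fun T => opf T).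
Proof.
split=> //.
- by move=> S T h; apply: op_ext => x; rewrite h.
- by move=> T; rewrite /= adj_op.
- by move=> f /(lift_op hH hA).
Qed.

Lemma mat_represents n :
  represents (S' := alg (mat_staralg (opalg hH) n)) (S := matAlg n (opsAlg ip))
    (mat_sub (lift_sub hH A)) (Mn A)
    (fun x : 'M[adjop hH]_n => map_mx (fun T : adjop hH => opf T) x).
Proof.
split.
- move=> x y /matrixP h; apply/matrixP => i j; apply: op_ext => z.
  by have := h i j; rewrite !mxE => ->.
- by apply/matrixP => i j; rewrite !mxE.
- by move=> x y; apply/matrixP => i j; rewrite !mxE.
- move=> a x; apply/matrixP => i j; rewrite [LHS]mxE [RHS]mxE [in RHS]mxE.
  exact: (congr1 (fun T : adjop hH => opf T) (mscalE (L := opalg hH) a x i j)).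
- move=> x y; apply/matrixP => i j; rewrite !mxE.
  rewrite (big_morph (fun T : adjop hH => opf T) (id1 := s0 (opsAlg ip)) (op1 := @sadd _ (opsAlg ip))
    (id2 := 0) (op2 := +%R)) //.
  by apply: eq_bigr => k _; rewrite !mxE.
- by move=> x; apply/matrixP => i j; rewrite !mxE /= adj_op.
- by move=> x; split=> h i j; have := h i j; rewrite !mxE.
- move=> x hx.
  have [F hF] := @choice _ _ (fun (t : 'I_n * 'I_n) (T : adjop hH) => opf T = x t.1 t.2)
    (fun t => lift_op hH hA (hx t.1 t.2)).
  exists (\matrix_(i, j) F (i, j)); apply/matrixP => i j.
  by rewrite !mxE hF.
Qed.
End OperatorTransfer.

Theorem theorem8p7 (R : realType) :
  (* (a) *)
  (forall (H K : lmodType R[i]) (ipH : H -> H -> R[i]) (ipK : K -> K -> R[i])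
          (A : opsAlg ipH -> Prop) (B : opsAlg ipK -> Prop)
          (phi : opsAlg ipH -> opsAlg ipK),
     is_hilbert ipH -> is_hilbert ipK -> Rstar_algebra ipH A -> Rstar_algebra ipK B ->
     jordan_star_iso A B phi -> orthoiso A B phi) /\
  (* (b) *)
  (forall (n : nat) (H K : lmodType R[i]) (ipH : H -> H -> R[i]) (ipK : K -> K -> R[i])
          (A : opsAlg ipH -> Prop) (B : opsAlg ipK -> Prop)
          (psi : matAlg n (opsAlg ipH) -> opsAlg ipK),
     (3 <= n)%N ->
     is_hilbert ipH -> is_hilbert ipK -> Rstar_algebra ipH A -> Rstar_algebra ipK B ->
     orthoiso (Mn A) B psi ->
     exists phi : matAlg n (opsAlg ipH) -> opsAlg ipK,
       [/\ jordan_star_iso (Mn A) B phi,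
           (forall p, is_proj (Mn A) p -> phi p = psi p) &
           (forall phi' : matAlg n (opsAlg ipH) -> opsAlg ipK,
              jordan_star_iso (Mn A) B phi' ->
              (forall p, is_proj (Mn A) p -> phi' p = psi p) ->
              forall x, Mn A x -> phi' x = phi x)]).
Proof.
(* A choice of preimages under [opf], controlled only on [B]; accordingly the transfer lemmas
   compare maps only on members of the algebras. *)
have lift (K : lmodType R[i]) (ipK : K -> K -> R[i]) (hK : is_hilbert ipK) (B : (K -> K) -> Prop) :
    Rstar_algebra ipK B -> exists l : (K -> K) -> opalg hK, forall f, B f -> opf (l f) = f.
  move=> hB; exists (fun f => epsilon (inhabits 0) (fun T : opalg hK => opf T = f)) => f Bf.
  exact: (epsilon_spec (inhabits (0 : opalg hK)) _ (lift_op hK hB Bf)).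
split=> [H K ipH ipK A B phi hH hK hA hB hphi | n H K ipH ipK A B psi n3 hH hK hA hB hpsi].
  have rA := op_represents hH hA; have rB := op_represents hK hB.
  have [l hl] := lift K ipK hK B hB; have sA := lift_subalg hH hA.
  pose phi' (T : opalg hH) : opalg hK := l (phi (opf T)).
  have phiE T : lift_sub hH A T -> phi (opf T) = opf (phi' T).
    by move=> hT; rewrite hl //; case: hphi => h _; exact: h.
  apply/(orthoiso_rep rA rB (F' := phi')); first by move=> p [hp _ _]; exact: phiE.
  apply: (jordan_orthoiso sA); apply/(jordan_rep rA rB _ _ _ _ phiE) => //.
  - exact: (subD sA).
  - exact: (subZ sA).
  - exact: (subM sA).
  - exact: (subS sA).
have rM := mat_represents hH hA n; have rB := op_represents hK hB.
set v := (fun x : 'M_n => _) in rM.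
have [l hl] := lift K ipK hK B hB; have sA := lift_subalg hH hA; have sM := mat_subalg n sA.
have sB := lift_subalg hK hB.
pose psi' x : opalg hK := l (psi (v x)).
have psiE p : is_proj (S := alg (mat_staralg (opalg hH) n)) (mat_sub (lift_sub hH A)) p ->
    psi (v p) = opf (psi' p).
  move=> pp; rewrite hl //; case: hpsi => h _ _.
  by case: (h (v p)) => //; exact/(rep_is_proj _ rM).
have hpsi' := (orthoiso_rep rM rB psiE).2 hpsi.
have aA : annihilated (lift_sub hH A) by exact: rstar_annihilated.
have aB : annihilated (lift_sub hK B) by exact: rstar_annihilated.
have [phi [jphi phipsi uphi]] := orthoiso_extension (@complex_archimedean R) (op_pos_cone hK) n3
  (@opalg_posdef _ _ _ hH) (@opalg_posdef _ _ _ hK) sA sB aA aB hpsi'.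
have jr := jordan_rep rM rB (subD sM) (subZ sM) (subM sM) (subS sM).
(* A left inverse of the injective map [v], needed to define the extension on all matrices of
   functions. *)
pose lv x := epsilon (inhabits (0 : mat_staralg (opalg hH) n)) (fun x' => v x' = x).
have lvE x' : lv (v x') = x'.
  apply: (rep_inj rM).
  by apply: (epsilon_spec (inhabits 0) (fun y => v y = v x')); exists x'.
pose phi0 x := opf (phi (lv x)).
have phi0E x : mat_sub (lift_sub hH A) x -> phi0 (v x) = opf (phi x) by rewrite /phi0 lvE.
exists phi0; split.
- exact/(jr phi phi0 phi0E).
- move=> p pp; have [Ap _ _] := pp; have [p' hp' ep] := rep_onto_mem rM Ap.
  rewrite -ep in pp *; have pp' := (rep_is_proj p' rM).2 pp.
  by rewrite phi0E // phipsi // -psiE.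
- move=> phi1 jphi1 agree x /(rep_onto_mem rM)[x' hx' <-].
  pose phi1' y : opalg hK := l (phi1 (v y)).
  have phi1E y : mat_sub (lift_sub hH A) y -> phi1 (v y) = opf (phi1' y).
    by move=> hy; rewrite hl //; case: jphi1 => h _; apply: h; exact/(rep_mem rM).
  rewrite phi1E // phi0E // (uphi phi1') //; first exact/(jr phi1' phi1 phi1E).
  move=> p pp; rewrite /phi1' agree //; apply/(rep_is_proj _ rM).
  by case: pp => Mp ppp sp; split.
Qed.
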